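(* Let $p:\mathcal{E}\to\mathcal{B}$ be a fibration with finite products. The following are equivalent: (i) The fibration $p$ is elementary. (ii) (a) Every arrow in $\Delta$ has all cocartesian lifts (i.e. for every $f:W\to Z$ in $\Delta$ and every $A$ over $W$ there is a cocartesian arrow over $f$ with domain $A$); and (b) the class of cocartesian arrows over $\Delta$ is product-stable and pairable. (iii) (a) For every object $X$ in $\mathcal{B}$ there are an object $\mathrm{I}_X$ over $X\times X$ and a cocartesian arrow $\partial_X:\top_X\to \mathrm{I}_X$ over $\mathrm{pr}_{1,1}:X\to X\times X$; and (b) the class of cocartesian arrows over $\Delta$ is product-stable and pairable. (iv) (a) The fibration $p$ has strict productive transporters; and (b) denoting by $\partial_X:\top_X\to \mathrm{I}_X$ the loop of the transporter on $X$, for every $X$ in $\mathcal{B}$ every arrow in the class $\Xi(\partial_X)$ is locally epic with respect to $p$. (v) (a) For every $X$ in $\mathcal{B}$ there are an object $\mathrm{I}_X$ over $X\times X$ and an arrow $\partial_X:\top_X\to\mathrm{I}_X$ over $\mathrm{pr}_{1,1}:X\to X\times X$; and (b) such that for every $X$ in $\mathcal{B}$ the arrows in the class $\Xi(\partial_X)$ are cocartesian. (vi) For every $X$ in $\mathcal{B}$ there is an object $\mathrm{I}_X$ over $X\times X$ such that, for every $Y,X$ in $\mathcal{B}$ and every $A$ over $Y\times X$, the assignment $$A\longmapsto (\mathrm{pr}_{1,2}^*A)\wedge(\mathrm{pr}_{2,3}^*\mathrm{I}_X)$$ gives rise to a left adjoint to the reindexing functor $\mathrm{pr}_{1,2,2}^*:\mathcal{E}_{Y\times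 X\times X}\to\mathcal{E}_{Y\times X}$.
   Context: **Fibrations.** For a functor $p:\mathcal{E}\to\mathcal{B}$, an object $A$ (arrow $\varphi$) of $\mathcal{E}$ is *over* $X$ (over $f$) if $p(A)=X$ ($p(\varphi)=f$); $\mathcal{E}_X$ is the subcategory of arrows over $\mathrm{id}_X$ (vertical arrows). Cartesian and cocartesian arrows are meant in the strong sense (universal property with respect to arrows over any arrow of $\mathcal{B}$ factoring through the given one). Fibrations are assumed cloven; $f^*:\mathcal{E}_Y\to\mathcal{E}_X$ is reindexing along $f:X\to Y$. A fibration *has finite products* if $\mathcal{B}$ and every fibre have finite products and reindexing preserves them (equivalently $\mathcal{B},\mathcal{E}$ have finite products and $p$ preserves them). $\top_X$ and $\wedge$ denote terminal object and binary product in the fibre $\mathcal{E}_X$. For arrows $\varphi_1:A_1\to B_1$, $\varphi_2:A_2\to B_2$ over the same arrow $f:X\to Y$, with $A_i$ over $X$ and $B_i$ over $Y$, $\varphi_1\wedge\varphi_2:A_1\wedge A_2\to B_1\wedge B_2$ is the induced arrow over $f$. In $\mathcal{B}$, $\mathrm{pr}_{i_1,\dots,i_k}$ denotes the arrow $\langle \mathrm{pr}_{i_1},\dots,\mathrm{pr}_{i_k}\rangle$ induced by projections, e.g. $\mathrm{pr}_{1,1}:X\to X\times X$ is the diagonal. **$\Delta$** is the class of arrows of $\mathcal{B}$ of the form $\mathrm{pr}_{1,2,2}:Y\times X\to Y\times X\times X$. An arrow of $\mathcal{E}$ is *over $\Delta$* if its image under $p$ is in $\Delta$. **Elementary.** $p$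 is *elementary* if for all $Y,X$ in $\mathcal{B}$ reindexing along $\mathrm{pr}_{1,2,2}:Y\times X\to Y\times X\times X$ has a left adjoint $\exists_{Y,X}:\mathcal{E}_{Y\times X}\to\mathcal{E}_{Y\times X\times X}$ and these satisfy: (Frobenius Reciprocity) for every $A$ over $Y\times X$ and $B$ over $Y\times X\times X$ the canonical arrow $\exists_{Y,X}(\mathrm{pr}_{1,2,2}^*B\wedge A)\to B\wedge\exists_{Y,X}A$ is iso; (Beck-Chevalley Condition) for every $f:Y\to Z$ and every $A$ over $Z\times X$ the canonical arrow $\exists_{Y,X}(f\times X)^*A\to (f\times X\times X)^*\exists_{Z,X}A$ is iso. **Product-stable, pairable.** Let $\Phi$ be a class of arrows of $\mathcal{E}$ over $\Delta$. $\Phi$ is *product-stable* if for every $g:U\to V$ and $X$ in $\mathcal{B}$, and every commutative square in $\mathcal{E}$ with $\varphi:A\to B$ in $\Phi$ over $\mathrm{pr}_{1,2,2}:V\times X\to V\times X\times X$, $\varphi':A'\to B'$ over $\mathrm{pr}_{1,2,2}:U\times X\to U\times X\times X$, and cartesian arrows $A'\to A$ over $g\times X$ and $B'\to B$ over $g\times X\times X$, also $\varphi'$ is in $\Phi$. $\Phi$ is *pairable* if for every $\varphi:A\to B$ in $\Phi$ and every cartesian arrow $\psi:C'\to C$ over $p(\varphi)$, the arrow $\varphi\wedge\psi:A\wedge C'\to B\wedge C$ is in $\Phi$. **Locally epic.** An arrow $\varphi:A\to B$ of $\mathcal{E}$ is *locally epic with respect to $p$* if for all $\psi,\psi':B\to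 B'$ with $p(\psi)=p(\psi')$, $\psi\varphi=\psi'\varphi$ implies $\psi=\psi'$. **Transporters.** A *loop* on $X$ is an object $\mathrm{I}_X$ over $X\times X$ with an arrow $\partial_X:\top_X\to\mathrm{I}_X$ over $\mathrm{pr}_{1,1}:X\to X\times X$. For $A$ over $X$, let $\delta_A=\langle d_A,\partial_X!_A\rangle:A\to(\mathrm{pr}_1^*A)\wedge \mathrm{I}_X$ over $\mathrm{pr}_{1,1}$, where $!_A:A\to\top_X$ and $d_A:A\to\mathrm{pr}_1^*A$ is the unique arrow over $\mathrm{pr}_{1,1}$ whose composite with the cartesian arrow $\mathrm{pr}_1^*A\to A$ is $\mathrm{id}_A$. A *carrier* for the loop at $A$ is an arrow $\mathrm{t}_A:(\mathrm{pr}_1^*A)\wedge\mathrm{I}_X\to A$ over $\mathrm{pr}_2:X\times X\to X$; it is *strict* if $\mathrm{t}_A\delta_A=\mathrm{id}_A$. A *strict transporter* on $X$ is a loop on $X$ together with a strict carrier at every $A$ over $X$. $p$ has *strict productive transporters* if it has a strict transporter on each $X$ in $\mathcal{B}$ and, for all $X,Y$, there is a vertical arrow $\chi_{X,Y}:\mathrm{I}_X\boxtimes\mathrm{I}_Y\to\mathrm{I}_{X\times Y}$ with $\chi_{X,Y}\circ(\partial_X\boxtimes\partial_Y)=\partial_{X\times Y}$; here $\mathrm{I}_X\boxtimes\mathrm{I}_Y=(\mathrm{pr}_{1,3}^*\mathrm{I}_X)\wedge(\mathrm{pr}_{2,4}^*\mathrm{I}_Y)$ over $X\times Y\times X\times Y$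 is the product in $\mathcal{E}$, and $\partial_X\boxtimes\partial_Y:\top_{X\times Y}\to\mathrm{I}_X\boxtimes\mathrm{I}_Y$, over $\mathrm{pr}_{1,2,1,2}$, is the product in $\mathcal{E}$ of $\partial_X$ and $\partial_Y$. **The class $\Xi(\partial_X)$.** For an arrow $\partial_X:\top_X\to\mathrm{I}_X$ over $\mathrm{pr}_{1,1}:X\to X\times X$, $\Xi(\partial_X)$ is the class of all arrows $\sigma\wedge\varphi':C\wedge A'\to C'\wedge B'$ obtained as follows, for some $U$ in $\mathcal{B}$: $\varphi':A'\to B'$ is over $\mathrm{pr}_{1,2,2}:U\times X\to U\times X\times X$ and there are cartesian arrows $A'\to\top_X$ over $\mathrm{pr}_2:U\times X\to X$ and $B'\to \mathrm{I}_X$ over $\mathrm{pr}_{2,3}:U\times X\times X\to X\times X$ forming with $\varphi'$ and $\partial_X$ a commutative square; $\rho:C'\to C$ is cartesian over $\mathrm{pr}_{1,2}:U\times X\times X\to U\times X$ and $\sigma:C\to C'$ is cartesian over $\mathrm{pr}_{1,2,2}:U\times X\to U\times X\times X$, with $\rho\sigma=\mathrm{id}_C$. *)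

(* Defs.v *)
From Stdlib Require Import ProofIrrelevance IndefiniteDescription.

Set Implicit Arguments.
Unset Strict Implicit.
Unset Printing Implicit Defensive.

Record Category : Type := {
  Ob :> Type;
  Hom : Ob -> Ob -> Type;
  id : forall A, Hom A A;
  comp : forall A B C, Hom B C -> Hom A B -> Hom A C;
  comp_id_l : forall A B (f : Hom A B), comp (id B) f = f;
  comp_id_r : forall A B (f : Hom A B), comp f (id A) = f;
  comp_assoc : forall A B C D (h : Hom C D) (g : Hom B C) (f : Hom A B),
    comp h (comp g f) = comp (comp h g) f
}.

Arguments Hom {c} _ _.
Arguments id {c} A.
Arguments comp {c A B C} _ _.

Notation "g ∘ f" := (comp g f) (at level 40, left associativity).

Definition is_iso {C : Category} {A B : C} (f : Hom A B) : Prop :=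
  exists g : Hom B A, g ∘ f = id A /\ f ∘ g = id B.

Record Functor (C D : Category) : Type := {
  fun_ob :> C -> D;
  fmap : forall A B : C, Hom A B -> Hom (fun_ob A) (fun_ob B);
  fmap_id : forall A : C, fmap (id A) = id (fun_ob A);
  fmap_comp : forall (A B B' : C) (g : Hom B B') (f : Hom A B),
    fmap (g ∘ f) = fmap g ∘ fmap f
}.

Arguments fmap {C D} _ {A B} _.

Definition functor_comp {C D D' : Category} (G : Functor D D') (F : Functor C D) :
  Functor C D'.
Proof.
  refine {| fun_ob := fun A : C => G (F A);
            fmap := fun (A B : C) (f : Hom A B) => fmap G (fmap F f) |}.
  - intros A. now rewrite !fmap_id.
  - intros A B B' g f. now rewrite !fmap_comp.
Defined.

(** [Adjunction L R] : [L] is left adjoint to [R]. *)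
Record Adjunction {C D : Category} (L : Functor C D) (R : Functor D C) : Type := {
  adj_unit : forall A : C, Hom A (R (L A));
  adj_counit : forall B : D, Hom (L (R B)) B;
  unit_natural : forall (A A' : C) (f : Hom A A'),
    adj_unit A' ∘ f = fmap R (fmap L f) ∘ adj_unit A;
  counit_natural : forall (B B' : D) (g : Hom B B'),
    adj_counit B' ∘ fmap L (fmap R g) = g ∘ adj_counit B;
  triangle_l : forall A : C, adj_counit (L A) ∘ fmap L (adj_unit A) = id (L A);
  triangle_r : forall B : D, fmap R (adj_counit B) ∘ adj_unit (R B) = id (R B)
}.

Definition is_terminal {C : Category} (T : C) : Prop :=
  forall A : C, exists f : Hom A T, forall g : Hom A T, g = f.

Definition is_product {C : Category} {A B P : C} (p1 : Hom P A) (p2 : Hom P B) : Prop :=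
  forall (D : C) (f : Hom D A) (g : Hom D B),
    exists! h : Hom D P, p1 ∘ h = f /\ p2 ∘ h = g.

Record FiniteProducts (C : Category) : Type := {
  one : C;
  one_terminal : is_terminal one;
  product : C -> C -> C;
  π1 : forall A B : C, Hom (product A B) A;
  π2 : forall A B : C, Hom (product A B) B;
  prod_product : forall A B : C, is_product (π1 A B) (π2 A B)
}.

Arguments π1 {C} _ {A B}.
Arguments π2 {C} _ {A B}.

Definition preserves_finite_products {C D : Category} (F : Functor C D)
    (PC : FiniteProducts C) : Prop :=
  is_terminal (F (one PC)) /\
  forall A B : C, is_product (fmap F (π1 PC (A := A) (B := B))) (fmap F (π2 PC)).

Section Products.
Context {C : Category} (P : FiniteProducts C).

Definition pairing {D A B : C} (f : Hom D A) (g : Hom D B) : Hom D (product P A B) :=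
  proj1_sig (constructive_definite_description _ (prod_product P f g)).

Lemma π1_pairing (D A B : C) (f : Hom D A) (g : Hom D B) : π1 P ∘ pairing f g = f.
Proof. unfold pairing; now destruct constructive_definite_description as [h [? ?]]. Qed.

Lemma π2_pairing (D A B : C) (f : Hom D A) (g : Hom D B) : π2 P ∘ pairing f g = g.
Proof. unfold pairing; now destruct constructive_definite_description as [h [? ?]]. Qed.

Lemma π1_pairing_comp (D' D A B : C) (f : Hom D A) (g : Hom D B) (h : Hom D' D) :
  π1 P ∘ (pairing f g ∘ h) = f ∘ h.
Proof. now rewrite comp_assoc, π1_pairing. Qed.

Lemma π2_pairing_comp (D' D A B : C) (f : Hom D A) (g : Hom D B) (h : Hom D' D) :
  π2 P ∘ (pairing f g ∘ h) = g ∘ h.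
Proof. now rewrite comp_assoc, π2_pairing. Qed.

Lemma pairing_ext (D A B : C) (f g : Hom D (product P A B)) :
  π1 P ∘ f = π1 P ∘ g -> π2 P ∘ f = π2 P ∘ g -> f = g.
Proof.
  intros e1 e2.
  destruct (prod_product P (π1 P ∘ f) (π2 P ∘ f)) as [h [_ u]].
  transitivity h; [symmetry|]; now apply u.
Qed.

Definition prod_right (K : C) : Functor C C.
Proof.
  refine {| fun_ob := fun A : C => product P A K;
            fmap := fun (A B : C) (f : Hom A B) => pairing (f ∘ π1 P) (π2 P) |}.
  - intros A. apply pairing_ext; rewrite ?π1_pairing, ?π2_pairing, comp_id_r; auto.
    apply comp_id_l.
  - intros A B B' g f.
    apply pairing_ext; rewrite ?π1_pairing_comp, ?π2_pairing_comp, ?π1_pairing, ?π2_pairing.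
    + now rewrite <- !comp_assoc, π1_pairing.
    + reflexivity.
Defined.

(** Iterated products associate to the left: [Y × X × X] is [(Y × X) × X], except that
    [X × Y × X × Y] is [(X × Y) × (X × Y)]. *)

Definition times {A A' B B' : C} (f : Hom A A') (g : Hom B B') :
    Hom (product P A B) (product P A' B') :=
  pairing (f ∘ π1 P) (g ∘ π2 P).

Definition pr_1_1 (X : C) : Hom X (product P X X) := pairing (id X) (id X).

Definition pr_1_2_2 (Y X : C) : Hom (product P Y X) (product P (product P Y X) X) :=
  pairing (pairing (π1 P) (π2 P)) (π2 P).

Definition pr_1_2 (Y X Z : C) : Hom (product P (product P Y X) Z) (product P Y X) :=
  pairing (π1 P ∘ π1 P) (π2 P ∘ π1 P).

Definition pr_2_3 (Y X Z : C) : Hom (product P (product P Y X) Z) (product P X Z) :=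
  pairing (π2 P ∘ π1 P) (π2 P).

Definition pr_1_3 (X Y : C) :
    Hom (product P (product P X Y) (product P X Y)) (product P X X) :=
  pairing (π1 P ∘ π1 P) (π1 P ∘ π2 P).

Definition pr_2_4 (X Y : C) :
    Hom (product P (product P X Y) (product P X Y)) (product P Y Y) :=
  pairing (π2 P ∘ π1 P) (π2 P ∘ π2 P).

Definition pr_1_2_1_2 (X Y : C) :
    Hom (product P X Y) (product P (product P X Y) (product P X Y)) :=
  pairing (pairing (π1 P) (π2 P)) (pairing (π1 P) (π2 P)).

Definition times_l {Y Z : C} (f : Hom Y Z) (X : C) : Hom (product P Y X) (product P Z X) :=
  times f (id X).

Definition times_ll {Y Z : C} (f : Hom Y Z) (X : C) :
    Hom (product P (product P Y X) X) (product P (product P Z X) X) :=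
  times (times_l f X) (id X).

End Products.

Ltac solve_prod :=
  unfold times_ll, times_l, times, pr_1_1, pr_1_2_2, pr_1_2, pr_2_3, pr_1_3, pr_2_4,
    pr_1_2_1_2;
  repeat match goal with |- @eq (Hom _ (product _ _ _)) _ _ => apply pairing_ext end;
  repeat (rewrite <- comp_assoc || rewrite π1_pairing_comp || rewrite π2_pairing_comp ||
    rewrite π1_pairing || rewrite π2_pairing || rewrite comp_id_l || rewrite comp_id_r);
  reflexivity.

Definition hom_cast {C : Category} {X X' Y Y' : C} (e : X = X') (e' : Y = Y')
    (f : Hom X Y) : Hom X' Y' :=
  match e in _ = X1, e' in _ = Y1 return Hom X1 Y1 with eq_refl, eq_refl => f end.

Section Over.
Context {E B : Category} (p : Functor E B).

Record ObOver (X : B) : Type := {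
  ob_of :> E;
  ob_over : p ob_of = X
}.

(** [p φ = f], transported along [p A = X] and [p A' = Y]. *)
Definition is_over {X Y : B} (f : Hom X Y) (A : ObOver X) (A' : ObOver Y)
    (φ : Hom A A') : Prop :=
  hom_cast (ob_over A) (ob_over A') (fmap p φ) = f.

Record HomOver {X Y : B} (f : Hom X Y) (A : ObOver X) (A' : ObOver Y) : Type := {
  hom_of :> Hom A A';
  hom_over : is_over f hom_of
}.

Lemma hom_over_eq (X Y : B) (f : Hom X Y) (A : ObOver X) (A' : ObOver Y)
    (φ ψ : HomOver f A A') : hom_of φ = hom_of ψ -> φ = ψ.
Proof.
  destruct φ as [φ hφ], ψ as [ψ hψ]; simpl; intros ->.
  now rewrite (proof_irrelevance _ hφ hψ).
Qed.

Lemma is_over_id (X : B) (A : ObOver X) : is_over (id X) (id A : Hom A A).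
Proof. destruct A as [A []]; unfold is_over; simpl. apply fmap_id. Qed.

Lemma is_over_comp (X Y Z : B) (f : Hom X Y) (g : Hom Y Z) (h : Hom X Z)
    (A : ObOver X) (A' : ObOver Y) (A'' : ObOver Z)
    (ψ : HomOver g A' A'') (φ : HomOver f A A') :
  g ∘ f = h -> is_over h (ψ ∘ φ : Hom A A'').
Proof.
  destruct ψ as [ψ hψ], φ as [φ hφ]; simpl. revert f g h φ ψ hφ hψ.
  destruct A as [A []], A' as [A' []], A'' as [A'' []]; unfold is_over; simpl.
  intros f g h φ ψ <- <- <-. apply fmap_comp.
Qed.

Definition id_over (X : B) (A : ObOver X) : HomOver (id X) A A :=
  {| hom_of := id (ob_of A); hom_over := is_over_id A |}.

Definition comp_over {X Y Z : B} {f : Hom X Y} {g : Hom Y Z} {h : Hom X Z}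
    {A : ObOver X} {A' : ObOver Y} {A'' : ObOver Z}
    (ψ : HomOver g A' A'') (φ : HomOver f A A') (e : g ∘ f = h) : HomOver h A A'' :=
  {| hom_of := hom_of ψ ∘ hom_of φ; hom_over := is_over_comp ψ φ e |}.

Definition fibre (X : B) : Category.
Proof.
  refine {| Ob := ObOver X;
            Hom := HomOver (id X);
            id := @id_over X;
            comp := fun A A' A'' (ψ : HomOver (id X) A' A'') (φ : HomOver (id X) A A') =>
              comp_over ψ φ (comp_id_l (id X)) |}.
  - intros A A' f. apply hom_over_eq; simpl. apply comp_id_l.
  - intros A A' f. apply hom_over_eq; simpl. apply comp_id_r.
  - intros A A' A'' A3 h g f. apply hom_over_eq; simpl. apply comp_assoc.
Defined.

Definition is_cartesian {A A' : E} (φ : Hom A A') : Prop :=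
  forall (D : E) (ψ : Hom D A') (h : Hom (p D) (p A)),
    fmap p φ ∘ h = fmap p ψ ->
    exists! χ : Hom D A, fmap p χ = h /\ φ ∘ χ = ψ.

Definition is_cocartesian {A A' : E} (φ : Hom A A') : Prop :=
  forall (D : E) (ψ : Hom A D) (h : Hom (p A') (p D)),
    h ∘ fmap p φ = fmap p ψ ->
    exists! χ : Hom A' D, fmap p χ = h /\ χ ∘ φ = ψ.

Definition locally_epic {A A' : E} (φ : Hom A A') : Prop :=
  forall (D : E) (ψ ψ' : Hom A' D),
    fmap p ψ = fmap p ψ' -> ψ ∘ φ = ψ' ∘ φ -> ψ = ψ'.

Lemma lift_exists (W X Y : B) (f : Hom X Y) (h : Hom W X) (g : Hom W Y)
    (D : ObOver W) (A : ObOver X) (A' : ObOver Y) (φ : HomOver f A A')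
    (cφ : is_cartesian φ) (ψ : HomOver g D A') :
  f ∘ h = g -> exists! χ : HomOver h D A, φ ∘ χ = ψ.
Proof.
  destruct ψ as [ψ hψ], φ as [φ hφ]; simpl in *. revert f g h φ cφ ψ hφ hψ.
  destruct D as [D []], A as [A []], A' as [A' []]; unfold is_over; simpl.
  intros f g h φ cφ ψ <- <- e. destruct (cφ D ψ h e) as [χ [[e1 e2] u]].
  exists {| hom_of := χ : Hom (Build_ObOver eq_refl) (Build_ObOver eq_refl);
            hom_over := e1 |}.
  split; [exact e2|].
  intros [χ' e1'] e2'. apply hom_over_eq; simpl in *. now apply u.
Qed.

(** The arrow over [h] induced by [ψ] through the cartesian arrow [φ]. *)
Definition lift {W X Y : B} {f : Hom X Y} {h : Hom W X} {g : Hom W Y}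
    {D : ObOver W} {A : ObOver X} {A' : ObOver Y} {φ : HomOver f A A'}
    (cφ : is_cartesian φ) (ψ : HomOver g D A') (e : f ∘ h = g) : HomOver h D A :=
  proj1_sig (constructive_definite_description _ (lift_exists cφ ψ e)).

Lemma lift_comp (W X Y : B) (f : Hom X Y) (h : Hom W X) (g : Hom W Y)
    (D : ObOver W) (A : ObOver X) (A' : ObOver Y) (φ : HomOver f A A')
    (cφ : is_cartesian φ) (ψ : HomOver g D A') (e : f ∘ h = g) :
  φ ∘ lift cφ ψ e = ψ.
Proof. unfold lift; now destruct constructive_definite_description. Qed.

Lemma lift_unique (W X Y : B) (f : Hom X Y) (h : Hom W X)
    (D : ObOver W) (A : ObOver X) (A' : ObOver Y) (φ : HomOver f A A')
    (cφ : is_cartesian φ) (χ χ' : HomOver h D A) :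
  φ ∘ χ = φ ∘ χ' -> χ = χ'.
Proof.
  intros e.
  destruct (lift_exists cφ (comp_over φ χ eq_refl) eq_refl) as [χ0 [_ u]].
  transitivity χ0; [symmetry|]; apply u; simpl; auto.
Qed.

Record Cleavage : Type := {
  reindex_ob : forall X Y : B, Hom X Y -> ObOver Y -> ObOver X;
  cart : forall (X Y : B) (f : Hom X Y) (A : ObOver Y), HomOver f (reindex_ob f A) A;
  cart_cartesian : forall (X Y : B) (f : Hom X Y) (A : ObOver Y), is_cartesian (cart f A)
}.

Arguments cart_cartesian c {X Y} f A.

Context (c : Cleavage).

Definition reindex_map {X Y : B} (f : Hom X Y) {A A' : ObOver Y}
    (v : HomOver (id Y) A A') :
    HomOver (id X) (reindex_ob c f A) (reindex_ob c f A') :=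
  lift (cart_cartesian c f A') (comp_over v (cart c f A) (comp_id_l f)) (comp_id_r f).

Definition reindex {X Y : B} (f : Hom X Y) : Functor (fibre Y) (fibre X).
Proof.
  refine {| fun_ob := fun A : fibre Y => reindex_ob c f A : fibre X;
            fmap := fun (A A' : fibre Y) (v : Hom A A') => reindex_map f v |}.
  - intros A. apply (lift_unique (cart_cartesian c f A)).
    unfold reindex_map; rewrite lift_comp; simpl. now rewrite comp_id_l, comp_id_r.
  - intros A A' A'' w v. apply (lift_unique (cart_cartesian c f A'')).
    unfold reindex_map; rewrite lift_comp; simpl.
    rewrite comp_assoc, lift_comp; simpl.
    now rewrite <- !comp_assoc, lift_comp.
Defined.

Record FibredFiniteProducts : Type := {
  base_prod : FiniteProducts B;
  fibre_prod : forall X : B, FiniteProducts (fibre X);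
  reindex_prod : forall (X Y : B) (f : Hom X Y),
    preserves_finite_products (reindex f) (fibre_prod Y)
}.

End Over.

Arguments cart_cartesian {E B p} c {X Y} f A.

Section FibrationsWithProducts.
Context {E B : Category} {p : Functor E B} {c : Cleavage p} (P : FibredFiniteProducts c).

Local Notation "X × Y" := (product (base_prod P) X Y) (at level 40, left associativity).
Local Notation pr_1 := (π1 (base_prod P)).
Local Notation pr_2 := (π2 (base_prod P)).
Local Notation pr_1_1 := (pr_1_1 (base_prod P)).
Local Notation pr_1_2_2 := (pr_1_2_2 (base_prod P)).
Local Notation pr_1_2 := (pr_1_2 (base_prod P)).
Local Notation pr_2_3 := (pr_2_3 (base_prod P)).
Local Notation pr_1_3 := (pr_1_3 (base_prod P)).
Local Notation pr_2_4 := (pr_2_4 (base_prod P)).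
Local Notation pr_1_2_1_2 := (pr_1_2_1_2 (base_prod P)).
Local Notation times_l := (times_l (base_prod P)).
Local Notation times_ll := (times_ll (base_prod P)).
Local Notation over X := (ObOver p X).
Local Notation "f ^* A" := (reindex_ob c f A) (at level 30, right associativity).

Definition top (X : B) : over X := one (fibre_prod P X).

Definition meet {X : B} (A A' : over X) : over X := product (fibre_prod P X) A A'.

Local Notation "⊤" := top.
Local Notation "A ⊓ A'" := (meet A A') (at level 45, left associativity).

Definition meet_pr1 {X : B} (A A' : over X) : HomOver (id X) (A ⊓ A') A :=
  π1 (fibre_prod P X).

Definition meet_pr2 {X : B} (A A' : over X) : HomOver (id X) (A ⊓ A') A' :=
  π2 (fibre_prod P X).

Lemma top_over_exists (X Y : B) (f : Hom X Y) (A : over X) :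
  exists! χ : HomOver f A (⊤ Y), True.
Proof.
  destruct (proj1 (reindex_prod P f) A) as [v u].
  exists (comp_over (cart c f (⊤ Y)) v (comp_id_r f)). split; [exact I|].
  intros χ' _.
  rewrite <- (u (lift (cart_cartesian c f (⊤ Y)) χ' (comp_id_r f))).
  apply hom_over_eq; simpl. apply lift_comp.
Qed.

Definition bang_over {X Y : B} (f : Hom X Y) (A : over X) : HomOver f A (⊤ Y) :=
  proj1_sig (constructive_definite_description _ (top_over_exists f A)).

Lemma meet_over_exists (X Y : B) (f : Hom X Y) (A : over X) (A1 A2 : over Y)
    (ψ1 : HomOver f A A1) (ψ2 : HomOver f A A2) :
  exists! χ : HomOver f A (A1 ⊓ A2),
    meet_pr1 A1 A2 ∘ χ = ψ1 /\ meet_pr2 A1 A2 ∘ χ = ψ2.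
Proof.
  pose (l := fun (A' : over Y) (ψ : HomOver f A A') =>
    lift (cart_cartesian c f A') ψ (comp_id_r f)).
  assert (L : forall (A' : over Y) (v : HomOver (id Y) (A1 ⊓ A2) A')
      (w : HomOver (id X) A (f ^* (A1 ⊓ A2))),
    v ∘ (cart c f (A1 ⊓ A2) ∘ w) = cart c f A' ∘ (reindex_map c f v ∘ w)).
  { intros A' v w. unfold reindex_map. rewrite !comp_assoc, lift_comp. reflexivity. }
  destruct (proj2 (reindex_prod P f) A1 A2 A (l A1 ψ1) (l A2 ψ2)) as [v [[e1 e2] u]].
  apply (f_equal (@hom_of _ _ _ _ _ _ _ _)) in e1, e2.
  exists (comp_over (cart c f (A1 ⊓ A2)) v (comp_id_r f)). split.
  - simpl. split.
    + etransitivity; [apply L|]. etransitivity; [apply f_equal, e1|]. apply lift_comp.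
    + etransitivity; [apply L|]. etransitivity; [apply f_equal, e2|]. apply lift_comp.
  - intros χ [h1 h2].
    rewrite (u (l (A1 ⊓ A2) χ)).
    + apply hom_over_eq. apply lift_comp.
    + split; apply (lift_unique (cart_cartesian c f _)).
      * etransitivity; [symmetry; apply L|]. unfold l; rewrite !lift_comp. exact h1.
      * etransitivity; [symmetry; apply L|]. unfold l; rewrite !lift_comp. exact h2.
Qed.

Definition pairing_over {X Y : B} {f : Hom X Y} {A : over X} {A1 A2 : over Y}
    (ψ1 : HomOver f A A1) (ψ2 : HomOver f A A2) : HomOver f A (A1 ⊓ A2) :=
  proj1_sig (constructive_definite_description _ (meet_over_exists ψ1 ψ2)).

Definition meet_map {X Y : B} {f : Hom X Y} {A1 A2 : over X} {B1 B2 : over Y}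
    (φ1 : HomOver f A1 B1) (φ2 : HomOver f A2 B2) : HomOver f (A1 ⊓ A2) (B1 ⊓ B2) :=
  pairing_over (comp_over φ1 (meet_pr1 A1 A2) (comp_id_r f))
               (comp_over φ2 (meet_pr2 A1 A2) (comp_id_r f)).

Section LeftAdjoints.
Context (Ex : forall Y X : B, Functor (fibre p (Y × X)) (fibre p (Y × X × X)))
        (adj : forall Y X : B, Adjunction (Ex Y X) (reindex c (pr_1_2_2 Y X))).

Definition frobenius_arrow (Y X : B) (A : fibre p (Y × X)) (D : fibre p (Y × X × X)) :
    Hom (Ex Y X (product (fibre_prod P (Y × X)) (reindex c (pr_1_2_2 Y X) D) A))
        (product (fibre_prod P (Y × X × X)) D (Ex Y X A)) :=
  pairing (fibre_prod P (Y × X × X))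
    (adj_counit (adj Y X) D ∘ fmap (Ex Y X) (π1 (fibre_prod P (Y × X))))
    (fmap (Ex Y X) (π2 (fibre_prod P (Y × X)))).

Definition frobenius_reciprocity : Prop :=
  forall (Y X : B) (A : fibre p (Y × X)) (D : fibre p (Y × X × X)),
    is_iso (frobenius_arrow A D).

(** The unit of the adjunction seen as an arrow [A -> Ex A] over [pr_1_2_2]. *)
Definition unit_over (Y X : B) (A : over (Y × X)) :
    HomOver (pr_1_2_2 Y X) A (Ex Y X A : fibre p (Y × X × X)) :=
  comp_over (cart c (pr_1_2_2 Y X) (Ex Y X A : fibre p (Y × X × X)))
    (adj_unit (adj Y X) A) (comp_id_r (pr_1_2_2 Y X)).

Lemma times_ll_pr_1_2_2 (Y Z : B) (f : Hom Y Z) (X : B) :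
  times_ll f X ∘ pr_1_2_2 Y X = pr_1_2_2 Z X ∘ times_l f X.
Proof. solve_prod. Qed.

(** [(f × X)^* A -> (f × X × X)^* (Ex A)] over [pr_1_2_2], induced by the unit at [A]. *)
Definition beck_chevalley_over (Y Z : B) (f : Hom Y Z) (X : B) (A : over (Z × X)) :
    HomOver (pr_1_2_2 Y X) (times_l f X ^* A)
      (times_ll f X ^* (Ex Z X A : fibre p (Z × X × X))) :=
  lift (cart_cartesian c (times_ll f X) _)
    (comp_over (unit_over A) (cart c (times_l f X) A) eq_refl)
    (times_ll_pr_1_2_2 f X).

(** The mate: transpose of [beck_chevalley_over] along [Ex ⊣ pr_1_2_2^*]. *)
Definition beck_chevalley_arrow (Y Z : B) (f : Hom Y Z) (X : B) (A : fibre p (Z × X)) :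
    Hom (Ex Y X (reindex c (times_l f X) A)) (reindex c (times_ll f X) (Ex Z X A)) :=
  adj_counit (adj Y X) (reindex c (times_ll f X) (Ex Z X A)) ∘
  fmap (Ex Y X)
    (lift (cart_cartesian c (pr_1_2_2 Y X) _) (beck_chevalley_over f A)
       (comp_id_r (pr_1_2_2 Y X))
     : @Hom (fibre p (Y × X)) (reindex c (times_l f X) A)
         (reindex c (pr_1_2_2 Y X) (reindex c (times_ll f X) (Ex Z X A)))).

Definition beck_chevalley : Prop :=
  forall (Y Z : B) (f : Hom Y Z) (X : B) (A : fibre p (Z × X)),
    is_iso (beck_chevalley_arrow f A).

End LeftAdjoints.

Definition elementary : Prop :=
  exists (Ex : forall Y X : B, Functor (fibre p (Y × X)) (fibre p (Y × X × X)))
         (adj : forall Y X : B, Adjunction (Ex Y X) (reindex c (pr_1_2_2 Y X))),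
    frobenius_reciprocity adj /\ beck_chevalley adj.

Definition ArrowClass : Type := forall A A' : E, Hom A A' -> Prop.

Definition over_Delta {A A' : E} (φ : Hom A A') : Prop :=
  exists (Y X : B) (e : p A = Y × X) (e' : p A' = Y × X × X),
    hom_cast e e' (fmap p φ) = pr_1_2_2 Y X.

Definition cocartesian_over_Delta : ArrowClass :=
  fun A A' φ => is_cocartesian p φ /\ over_Delta φ.

Definition cocartesian_lifts_of_Delta : Prop :=
  forall (Y X : B) (A : over (Y × X)),
    exists (A' : over (Y × X × X)) (φ : HomOver (pr_1_2_2 Y X) A A'),
      is_cocartesian p φ.

Definition product_stable (Φ : ArrowClass) : Prop :=
  forall (U V : B) (g : Hom U V) (X : B)
    (A : over (V × X)) (D : over (V × X × X)) (φ : HomOver (pr_1_2_2 V X) A D)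
    (A' : over (U × X)) (D' : over (U × X × X)) (φ' : HomOver (pr_1_2_2 U X) A' D')
    (α : HomOver (times_l g X) A' A) (β : HomOver (times_ll g X) D' D),
    is_cartesian p α -> is_cartesian p β -> β ∘ φ' = φ ∘ α ->
    Φ A D φ -> Φ A' D' φ'.

Definition pairable (Φ : ArrowClass) : Prop :=
  forall (X Y : B) (f : Hom X Y)
    (A : over X) (D : over Y) (φ : HomOver f A D)
    (C' : over X) (C : over Y) (ψ : HomOver f C' C),
    Φ A D φ -> is_cartesian p ψ -> Φ (A ⊓ C') (D ⊓ C) (meet_map φ ψ).

Record Loop (X : B) : Type := {
  loop_ob : over (X × X);
  loop_arr : HomOver (pr_1_1 X) (⊤ X) loop_ob
}.

Lemma pr_1_pr_1_1 (X : B) : pr_1 ∘ pr_1_1 X = id X.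
Proof. solve_prod. Qed.

(** [d_A] and [δ_A] *)
Definition diag_lift {X : B} (A : over X) : HomOver (pr_1_1 X) A (pr_1 ^* A) :=
  lift (cart_cartesian c pr_1 A) (id_over A) (pr_1_pr_1_1 X).

Definition delta {X : B} (L : Loop X) (A : over X) :
    HomOver (pr_1_1 X) A (pr_1 ^* A ⊓ loop_ob L) :=
  pairing_over (diag_lift A)
    (comp_over (loop_arr L) (bang_over (id X) A) (comp_id_r (pr_1_1 X))).

Definition Carrier {X : B} (L : Loop X) (A : over X) : Type :=
  HomOver pr_2 (pr_1 ^* A ⊓ loop_ob L) A.

Definition strict {X : B} {L : Loop X} {A : over X} (t : Carrier L A) : Prop :=
  hom_of t ∘ delta L A = id (ob_of A).

Record StrictTransporter (X : B) : Type := {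
  tr_loop : Loop X;
  tr_carrier : forall A : over X, Carrier tr_loop A;
  tr_strict : forall A : over X, strict (tr_carrier A)
}.

Definition box {X Y : B} (A : over (X × X)) (D : over (Y × Y)) :
    over (X × Y × (X × Y)) :=
  (pr_1_3 X Y ^* A) ⊓ (pr_2_4 X Y ^* D).

Lemma pr_1_3_pr_1_2_1_2 (X Y : B) :
  pr_1_3 X Y ∘ pr_1_2_1_2 X Y = pr_1_1 X ∘ pr_1.
Proof. solve_prod. Qed.

Lemma pr_2_4_pr_1_2_1_2 (X Y : B) :
  pr_2_4 X Y ∘ pr_1_2_1_2 X Y = pr_1_1 Y ∘ pr_2.
Proof. solve_prod. Qed.

(** The product in [E] of the two loops, where [⊤ (X × Y)] is the product in [E] of
    [⊤ X] and [⊤ Y]. *)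
Definition box_loop {X Y : B} (L : Loop X) (M : Loop Y) :
    HomOver (pr_1_2_1_2 X Y) (⊤ (X × Y)) (box (loop_ob L) (loop_ob M)) :=
  pairing_over
    (lift (cart_cartesian c (pr_1_3 X Y) (loop_ob L))
       (comp_over (loop_arr L) (bang_over pr_1 (⊤ (X × Y))) eq_refl)
       (pr_1_3_pr_1_2_1_2 X Y))
    (lift (cart_cartesian c (pr_2_4 X Y) (loop_ob M))
       (comp_over (loop_arr M) (bang_over pr_2 (⊤ (X × Y))) eq_refl)
       (pr_2_4_pr_1_2_1_2 X Y)).

Definition productive (T : forall X : B, StrictTransporter X) : Prop :=
  forall X Y : B,
    exists χ : HomOver (id (X × Y × (X × Y)))
        (box (loop_ob (tr_loop (T X))) (loop_ob (tr_loop (T Y))))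
        (loop_ob (tr_loop (T (X × Y)))),
      hom_of χ ∘ box_loop (tr_loop (T X)) (tr_loop (T Y)) = loop_arr (tr_loop (T (X × Y))).

Inductive Xi {X : B} (L : Loop X) : ArrowClass :=
| Xi_intro : forall (U : B)
    (A' : over (U × X)) (D' : over (U × X × X)) (φ' : HomOver (pr_1_2_2 U X) A' D')
    (α : HomOver pr_2 A' (⊤ X)) (β : HomOver (pr_2_3 U X X) D' (loop_ob L))
    (C : over (U × X)) (C' : over (U × X × X))
    (ρ : HomOver (pr_1_2 U X X) C' C) (σ : HomOver (pr_1_2_2 U X) C C'),
    is_cartesian p α -> is_cartesian p β -> β ∘ φ' = loop_arr L ∘ α ->
    is_cartesian p ρ -> is_cartesian p σ -> ρ ∘ σ = id (ob_of C) ->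
    Xi L (meet_map σ φ').

Definition transport_functor (Y X : B) (D : over (X × X)) :
    Functor (fibre p (Y × X)) (fibre p (Y × X × X)) :=
  functor_comp (prod_right (fibre_prod P (Y × X × X)) (pr_2_3 Y X X ^* D))
    (reindex c (pr_1_2 Y X X)).

End FibrationsWithProducts.

Arguments transport_functor {E B p c} P Y X D.

(* Main.v *)
(** Conditions (ii)-(vi) all amount to path induction: for every [A] over [U × X] the arrow
    [a ↦ (a, ∂)] from [A] to [pr_{1,2}^*A ∧ pr_{2,3}^*I_X] is cocartesian. Up to isomorphism these
    arrows are the members of [Ξ(∂_X)].
    - Under (iv), an arrow [ψ] from [A] to a [D] over [U × X × X] is extended to
      [(a, q) ↦ t_D(ψ(a), χ(∂_{U × X}, q))]; uniqueness is local epicness.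
    - Path induction yields inverses of paths, and transport along [q] in an object over
      [U × X × X] is inverse to transport along [q^{-1}]; this gives pairability, that is,
      Frobenius reciprocity.
    - In (vi) the units only provide, for each [U], a section [k_U] of [I_X] over the diagonal
      satisfying path induction at [U], and nothing relates these sections for different [U].
      However, the sections for [U] and [U × X] together suffice to compose and invert paths over
      [U]. Hence every section of [I_X] over the diagonal is the image of [k_U] under an
      automorphism of [I_X], so every section satisfies path induction; in particular the
      reindexings of a fixed [∂_X] do. *)

From Stdlib Require Import IndefiniteDescription.
Require Import Defs.

Set Implicit Arguments.
Unset Strict Implicit.
Unset Printing Implicit Defensive.

(** Its base point is an arbitrary [x : S -> X], since paths must also start at a coordinate other
    than the last.

    For (vi), the basic operation [d] takes two paths with a common source, q1 : x ~ y and q2 : x ~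
    w, to a path y ~ w. It is defined by prescribing its value on a pair of loops. The second loop
    of that pair comes from the section for U × X and may differ from [k_U], so it first has to be
    shown to determine arrows as [k_U] does. The reversal q ↦ d(q, h) exchanges [k_U] with a given
    section h, but lies over the swap of the end points; a second reversal, fixing [k_U], makes the
    automorphism vertical.

    Since [p A = X] is a propositional equality, arrows are compared as bare arrows of [E] with side
    conditions [is_over]; the equality of the base arrows is a separate goal, and no transport
    enters the equations. *)

Section Isomorphisms.
Context {C : Category}.

Lemma iso_id (A : C) : is_iso (id A).
Proof. exists (id A); split; apply comp_id_l. Qed.

Lemma iso_comp (X Y Z : C) (g : Hom Y Z) (f : Hom X Y) :
  is_iso g -> is_iso f -> is_iso (g ∘ f).
Proof.
  intros [g' [g1 g2]] [f' [f1 f2]]. exists (f' ∘ g'); split.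
  - now rewrite <- comp_assoc, (comp_assoc g' g f), g1, comp_id_l.
  - now rewrite <- comp_assoc, (comp_assoc f f' g'), f2, comp_id_l.
Qed.

End Isomorphisms.

(** * Cartesian, cocartesian and locally epic arrows *)

Section Arrows.
Context {E B : Category} (p : Functor E B).

Lemma iso_cocartesian (A A' : E) (φ : Hom A A') : is_iso φ -> is_cocartesian p φ.
Proof.
  intros [i [e1 e2]] D ψ h e. exists (ψ ∘ i); repeat split.
  - rewrite fmap_comp, <- e, <- comp_assoc, <- fmap_comp, e2, fmap_id. apply comp_id_r.
  - now rewrite <- comp_assoc, e1, comp_id_r.
  - intros χ [_ <-]. now rewrite <- comp_assoc, e2, comp_id_r.
Qed.

Lemma iso_cartesian (A A' : E) (φ : Hom A A') : is_iso φ -> is_cartesian p φ.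
Proof.
  intros [i [e1 e2]] D ψ h e. exists (i ∘ ψ); repeat split.
  - rewrite fmap_comp, <- e, comp_assoc, <- fmap_comp, e1, fmap_id. apply comp_id_l.
  - now rewrite comp_assoc, e2, comp_id_l.
  - intros χ [_ <-]. now rewrite comp_assoc, e1, comp_id_l.
Qed.

Lemma cocartesian_comp (A A' A'' : E) (ψ : Hom A' A'') (φ : Hom A A') :
  is_cocartesian p ψ -> is_cocartesian p φ -> is_cocartesian p (ψ ∘ φ).
Proof.
  intros cψ cφ D θ h e.
  destruct (cφ D θ (h ∘ fmap p ψ)) as [χ [[e1 e2] u]].
  { now rewrite <- e, fmap_comp, comp_assoc. }
  destruct (cψ D χ h) as [χ' [[e1' e2'] u']]; [now symmetry|].
  exists χ'; repeat split; [exact e1'|now rewrite comp_assoc, e2'|].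
  intros χ2 [h1 h2]. apply u'; split; [exact h1|]. symmetry; apply u; split.
  - now rewrite fmap_comp, h1.
  - now rewrite <- comp_assoc.
Qed.

Lemma cartesian_comp (A A' A'' : E) (ψ : Hom A' A'') (φ : Hom A A') :
  is_cartesian p ψ -> is_cartesian p φ -> is_cartesian p (ψ ∘ φ).
Proof.
  intros cψ cφ D θ h e.
  destruct (cψ D θ (fmap p φ ∘ h)) as [χ [[e1 e2] u]].
  { now rewrite <- e, fmap_comp, comp_assoc. }
  destruct (cφ D χ h) as [χ' [[e1' e2'] u']]; [now symmetry|].
  exists χ'; repeat split; [exact e1'|now rewrite <- comp_assoc, e2'|].
  intros χ2 [h1 h2]. apply u'; split; [exact h1|]. symmetry; apply u; split.
  - now rewrite fmap_comp, h1.
  - now rewrite comp_assoc.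
Qed.

Lemma cartesian_cancel (A A' A'' : E) (ψ : Hom A' A'') (φ : Hom A A') :
  is_cartesian p ψ -> is_cartesian p (ψ ∘ φ) -> is_cartesian p φ.
Proof.
  intros cψ cψφ D θ h e.
  destruct (cψφ D (ψ ∘ θ) h) as [χ [[e1 e2] u]].
  { now rewrite !fmap_comp, <- comp_assoc, e. }
  exists χ; repeat split; [exact e1| |].
  - destruct (cψ D (ψ ∘ θ) (fmap p θ)) as [θ' [_ u']]; [now rewrite fmap_comp|].
    transitivity θ'; [symmetry|]; apply u'; split; auto.
    + now rewrite fmap_comp, e1.
    + now rewrite comp_assoc.
  - intros χ' [h1 h2]. apply u; split; [exact h1|]. now rewrite <- comp_assoc, h2.
Qed.

(** The isomorphisms need not be vertical, so this also moves cocartesianness along a change of base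
    such as 1 × X ≅ X. *)
Lemma cocartesian_iso_square (A A' D D' : E) (φ : Hom A D) (φ' : Hom A' D')
    (α : Hom A' A) (β : Hom D' D) :
  is_iso α -> is_iso β -> β ∘ φ' = φ ∘ α -> is_cocartesian p φ -> is_cocartesian p φ'.
Proof.
  intros iα [β' [b1 b2]] e cφ.
  assert (φ' = β' ∘ (φ ∘ α)) as -> by now rewrite <- e, comp_assoc, b1, comp_id_l.
  apply cocartesian_comp; [apply iso_cocartesian; now exists β|].
  apply cocartesian_comp; [exact cφ|now apply iso_cocartesian].
Qed.

Lemma cocartesian_locally_epic (A A' : E) (φ : Hom A A') :
  is_cocartesian p φ -> locally_epic p φ.
Proof.
  intros cφ D ψ ψ' e1 e2.
  destruct (cφ D (ψ ∘ φ) (fmap p ψ)) as [χ [_ u]]; [now rewrite fmap_comp|].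
  transitivity χ; [symmetry|]; now apply u.
Qed.

Lemma locally_epic_comp (A A' A'' : E) (ψ : Hom A' A'') (φ : Hom A A') :
  locally_epic p ψ -> locally_epic p φ -> locally_epic p (ψ ∘ φ).
Proof.
  intros lψ lφ D θ θ' e1 e2. apply lψ; [exact e1|]. apply lφ.
  - now rewrite !fmap_comp, e1.
  - now rewrite <- !comp_assoc.
Qed.

Lemma locally_epic_iso_square (A A' D D' : E) (φ : Hom A D) (φ' : Hom A' D')
    (α : Hom A' A) (β : Hom D' D) :
  is_iso α -> is_iso β -> β ∘ φ' = φ ∘ α -> locally_epic p φ -> locally_epic p φ'.
Proof.
  intros iα [β' [b1 b2]] e cφ.
  assert (φ' = β' ∘ (φ ∘ α)) as -> by now rewrite <- e, comp_assoc, b1, comp_id_l.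
  apply locally_epic_comp.
  - apply cocartesian_locally_epic, iso_cocartesian; now exists β.
  - apply locally_epic_comp; [exact cφ|].
    now apply cocartesian_locally_epic, iso_cocartesian.
Qed.

(** Only the proof component is transported, so the cast disappears under [hom_of]. *)
Definition cast_over {X Y : B} {f g : Hom X Y} {A : ObOver p X} {A' : ObOver p Y}
    (e : f = g) (φ : HomOver f A A') : HomOver g A A' :=
  {| hom_of := hom_of φ; hom_over := eq_ind f (fun g => is_over g φ) (hom_over φ) g e |}.

Lemma over_comp (X Y Z : B) (f : Hom X Y) (g : Hom Y Z)
    (A : ObOver p X) (A' : ObOver p Y) (A'' : ObOver p Z) (ψ : Hom A' A'') (φ : Hom A A') :
  is_over g ψ -> is_over f φ -> is_over (g ∘ f) (ψ ∘ φ).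
Proof.
  intros hψ hφ.
  exact (is_over_comp (Build_HomOver hψ) (Build_HomOver hφ) eq_refl).
Qed.

(** The two base arrows are kept apart: composites usually lie over arrows that are only provably
    equal. *)
Lemma over_cartesian_ext (W X Y : B) (f : Hom X Y) (h h' : Hom W X)
    (D : ObOver p W) (A : ObOver p X) (A' : ObOver p Y) (φ : HomOver f A A')
    (χ χ' : Hom D A) :
  is_cartesian p φ -> is_over h χ -> is_over h' χ' -> h = h' -> φ ∘ χ = φ ∘ χ' -> χ = χ'.
Proof.
  intros cφ o o' e. subst h'. intros eφ.
  exact (f_equal (@hom_of _ _ _ _ _ _ _ _)
    (lift_unique cφ (χ := Build_HomOver o) (χ' := Build_HomOver o') eφ)).
Qed.

Lemma colift_exists (X Y Z : B) (f : Hom X Y) (h : Hom Y Z) (g : Hom X Z)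
    (A : ObOver p X) (A' : ObOver p Y) (D : ObOver p Z) (φ : HomOver f A A')
    (cφ : is_cocartesian p φ) (ψ : HomOver g A D) :
  h ∘ f = g -> exists χ : HomOver h A' D, χ ∘ φ = ψ.
Proof.
  destruct ψ as [ψ hψ], φ as [φ hφ]; simpl in *. revert f g h φ cφ ψ hφ hψ.
  destruct D as [D []], A as [A []], A' as [A' []]; unfold is_over; simpl.
  intros f g h φ cφ ψ <- <- e. destruct (cφ D ψ h e) as [χ [[e1 e2] u]].
  now exists {| hom_of := χ : Hom (Build_ObOver eq_refl) (Build_ObOver eq_refl);
                hom_over := e1 |}.
Qed.

Lemma over_locally_epic_ext (X Y Z : B) (f : Hom X Y) (h h' : Hom Y Z)
    (A : ObOver p X) (A' : ObOver p Y) (D : ObOver p Z) (φ : HomOver f A A')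
    (χ χ' : Hom A' D) :
  locally_epic p φ -> is_over h χ -> is_over h' χ' -> h = h' -> χ ∘ φ = χ' ∘ φ -> χ = χ'.
Proof.
  destruct φ as [φ hφ]; simpl in *. revert f h h' φ χ χ' hφ.
  destruct D as [D []], A as [A []], A' as [A' []]; unfold is_over; simpl.
  intros f h h' φ χ χ' <- lφ <- <- e1 e2. now apply lφ.
Qed.

Lemma over_cocartesian_ext (X Y Z : B) (f : Hom X Y) (h h' : Hom Y Z)
    (A : ObOver p X) (A' : ObOver p Y) (D : ObOver p Z) (φ : HomOver f A A')
    (χ χ' : Hom A' D) :
  is_cocartesian p φ -> is_over h χ -> is_over h' χ' -> h = h' -> χ ∘ φ = χ' ∘ φ -> χ = χ'.
Proof. intros cφ. apply over_locally_epic_ext. now apply cocartesian_locally_epic. Qed.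

Lemma over_cartesian (X Y : B) (f : Hom X Y) (A : ObOver p X) (A' : ObOver p Y)
    (φ : HomOver f A A') :
  (forall (W : B) (h : Hom W X) (D : ObOver p W) (ψ : HomOver (f ∘ h) D A'),
     exists χ : HomOver h D A, φ ∘ χ = ψ /\
       forall χ' : HomOver h D A, φ ∘ χ' = ψ -> hom_of χ' = hom_of χ) ->
  is_cartesian p φ.
Proof.
  intros H. destruct φ as [φ hφ]; simpl in *. revert f φ hφ H.
  destruct A as [A []], A' as [A' []]; unfold is_over; simpl.
  intros f φ <- H D ψ h e.
  destruct (H (p D) h (Build_ObOver eq_refl)
    {| hom_of := ψ : Hom (Build_ObOver eq_refl) (Build_ObOver eq_refl);
       hom_over := eq_sym e |}) as [[χ e1] [e2 u]].
  exists χ; repeat split; [exact e1|exact e2|].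
  intros χ' [e1' e2'].
  symmetry; exact (u {| hom_of := χ' : Hom (Build_ObOver eq_refl) (Build_ObOver eq_refl);
    hom_over := e1' |} e2').
Qed.

Lemma over_cocartesian (X Y : B) (f : Hom X Y) (A : ObOver p X) (A' : ObOver p Y)
    (φ : HomOver f A A') :
  (forall (Z : B) (h : Hom Y Z) (D : ObOver p Z) (ψ : HomOver (h ∘ f) A D),
     exists χ : HomOver h A' D, χ ∘ φ = ψ /\
       forall χ' : HomOver h A' D, χ' ∘ φ = ψ -> hom_of χ' = hom_of χ) ->
  is_cocartesian p φ.
Proof.
  intros H. destruct φ as [φ hφ]; simpl in *. revert f φ hφ H.
  destruct A as [A []], A' as [A' []]; unfold is_over; simpl.
  intros f φ <- H D ψ h e.
  destruct (H (p D) h (Build_ObOver eq_refl)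
    {| hom_of := ψ : Hom (Build_ObOver eq_refl) (Build_ObOver eq_refl);
       hom_over := eq_sym e |}) as [[χ e1] [e2 u]].
  exists χ; repeat split; [exact e1|exact e2|].
  intros χ' [e1' e2'].
  symmetry; exact (u {| hom_of := χ' : Hom (Build_ObOver eq_refl) (Build_ObOver eq_refl);
    hom_over := e1' |} e2').
Qed.

Lemma iso_over_inverse (X Y : B) (f : Hom X Y) (g : Hom Y X) (A : ObOver p X)
    (A' : ObOver p Y) (φ : HomOver f A A') (ψ : Hom A' A) :
  g ∘ f = id X -> f ∘ g = id Y -> ψ ∘ φ = id (ob_of A) -> φ ∘ ψ = id (ob_of A') ->
  is_over g ψ.
Proof.
  destruct φ as [φ hφ]; simpl in *. revert f g φ ψ hφ.
  destruct A as [A []], A' as [A' []]; unfold is_over; simpl.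
  intros f g φ ψ <- e1 e2 e3 e4.
  rewrite <- (comp_id_r g), <- fmap_id, <- e4, fmap_comp, comp_assoc, e1.
  now rewrite comp_id_l.
Qed.

Lemma vertical_iso (X : B) (A A' : ObOver p X) (φ : HomOver (id X) A A') :
  is_iso (hom_of φ) <-> is_iso (φ : @Hom (fibre p X) A A').
Proof.
  split.
  - intros [ψ [e1 e2]].
    exists {| hom_of := ψ; hom_over := iso_over_inverse (comp_id_l _) (comp_id_l _) e1 e2 |}.
    now split; apply hom_over_eq.
  - intros [ψ [e1 e2]]. exists (hom_of ψ).
    split; [now apply (f_equal (@hom_of _ _ _ _ _ _ _ _)) in e1
           |now apply (f_equal (@hom_of _ _ _ _ _ _ _ _)) in e2].
Qed.

Lemma cartesian_over_iso (X Y : B) (f : Hom X Y) (A : ObOver p X) (A' : ObOver p Y)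
    (φ : HomOver f A A') : is_cartesian p φ -> is_iso f -> is_iso (hom_of φ).
Proof.
  intros cφ [g [e1 e2]].
  exists (hom_of (lift cφ (id_over A') e2)).
  assert (R : φ ∘ lift cφ (id_over A') e2 = id (ob_of A')) by apply lift_comp.
  split; [|exact R].
  apply (over_cartesian_ext cφ (over_comp (hom_over _) (hom_over _)) (is_over_id A) e1).
  now rewrite comp_assoc, R, comp_id_l, comp_id_r.
Qed.

Lemma cartesian_compare_iso (X Y : B) (f : Hom X Y) (A A1 : ObOver p X) (A' : ObOver p Y)
    (φ : HomOver f A A') (ψ : HomOver f A1 A') (χ : HomOver (id X) A A1) :
  is_cartesian p φ -> is_cartesian p ψ -> ψ ∘ χ = φ -> is_iso (hom_of χ).
Proof.
  intros cφ cψ e. apply cartesian_over_iso; [|apply iso_id].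
  apply (cartesian_cancel cψ). now rewrite e.
Qed.

Lemma cocartesian_compare_iso (X Y : B) (f : Hom X Y) (A : ObOver p X) (A' A1 : ObOver p Y)
    (φ : HomOver f A A') (ψ : HomOver f A A1) (χ : HomOver (id Y) A' A1) :
  is_cocartesian p φ -> is_cocartesian p ψ -> χ ∘ φ = ψ -> is_iso (hom_of χ).
Proof.
  intros cφ cψ e.
  destruct (colift_exists cψ φ (comp_id_l f)) as [i ei].
  exists i; split.
  - apply (over_cocartesian_ext cφ (over_comp (hom_over _) (hom_over _)) (is_over_id A')
      (comp_id_l _)).
    now rewrite <- comp_assoc, e, ei, comp_id_l.
  - apply (over_cocartesian_ext cψ (over_comp (hom_over _) (hom_over _)) (is_over_id A1)
      (comp_id_l _)).
    now rewrite <- comp_assoc, ei, e, comp_id_l.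
Qed.

End Arrows.

(* In a fibration it suffices to test cocartesianness on vertical arrows. *)
Lemma locally_cocartesian {E B : Category} {p : Functor E B} (c : Cleavage p)
    (X Y : B) (f : Hom X Y) (A : ObOver p X) (A' : ObOver p Y) (φ : HomOver f A A') :
  (forall (D : ObOver p Y) (ψ : HomOver f A D),
     exists χ : HomOver (id Y) A' D, χ ∘ φ = ψ /\
       forall χ' : HomOver (id Y) A' D, χ' ∘ φ = ψ -> hom_of χ' = hom_of χ) ->
  is_cocartesian p φ.
Proof.
  intros H. apply over_cocartesian. intros Z h D ψ.
  pose (k := cart_cartesian c h D).
  destruct (H _ (lift k ψ eq_refl)) as [χ [e u]].
  exists (comp_over (cart c h D) χ (comp_id_r h)); split.
  - simpl. now rewrite <- comp_assoc, e, lift_comp.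
  - intros χ' e'.
    rewrite <- (lift_comp k χ' (comp_id_r h)). simpl. f_equal. apply u.
    apply (over_cartesian_ext k (over_comp (hom_over _) (hom_over _))
      (hom_over (lift k ψ eq_refl)) (comp_id_l f)).
    now rewrite comp_assoc, !lift_comp.
Qed.

(** * Cocartesian lifts and left adjoints to reindexing *)

Lemma hom_of_comp {E B : Category} {p : Functor E B} (X : B) (A A' A'' : fibre p X)
    (v : Hom A' A'') (u : Hom A A') :
  hom_of (v ∘ u) = hom_of v ∘ hom_of u.
Proof. reflexivity. Qed.

(** The unit factors [φ] through [κ] and the counit extends [κ] along [φ]; each law is tested after
    composing with a [κ] or a [φ], which are cancellable. *)
Lemma cocartesian_cartesian_adjunction {E B : Category} {p : Functor E B} (X Y : B)
    (f : Hom X Y) (L : Functor (fibre p X) (fibre p Y)) (R : Functor (fibre p Y) (fibre p X))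
    (φ : forall A : fibre p X, HomOver f A (L A : fibre p Y))
    (κ : forall D : fibre p Y, HomOver f (R D : fibre p X) D) :
  (forall D : fibre p Y, is_cartesian p (κ D)) ->
  (forall (D D' : fibre p Y) (v : Hom D D'),
     κ D' ∘ hom_of (fmap R v) = hom_of v ∘ κ D) ->
  (forall A : fibre p X, is_cocartesian p (φ A)) ->
  (forall (A A' : fibre p X) (v : Hom A A'),
     φ A' ∘ hom_of v = hom_of (fmap L v) ∘ φ A) ->
  inhabited (Adjunction L R).
Proof.
  intros cκ natκ cφ nat.
  pose (η := fun A : fibre p X => lift (cκ (L A)) (φ A) (comp_id_r f) :
    @Hom (fibre p X) A (R (L A))).
  assert (Hη : forall A, κ (L A) ∘ hom_of (η A) = φ A) by (intros; apply lift_comp).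
  assert (HC : forall D : fibre p Y,
    {ε : @Hom (fibre p Y) (L (R D)) D | hom_of ε ∘ φ (R D) = κ D}).
  { intros D. apply constructive_indefinite_description.
    apply (colift_exists (cφ (R D)) (κ D) (comp_id_l f)). }
  pose (ε := fun D => proj1_sig (HC D)).
  assert (Hε : forall D, hom_of (ε D) ∘ φ (R D) = κ D)
    by (intros D; unfold ε; now destruct (HC D)).
  assert (ext : forall (A : fibre p X) (D : fibre p Y) (u v : @Hom (fibre p Y) (L A) D),
    hom_of u ∘ φ A = hom_of v ∘ φ A -> u = v).
  { intros A D u v e. apply hom_over_eq. exact (over_cocartesian_ext (cφ A) (hom_over u)
    (hom_over v) eq_refl e). }
  constructor. unshelve eapply (@Build_Adjunction _ _ L R η ε).
  - intros A A' v. apply (lift_unique (cκ _)).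
    rewrite !hom_of_comp, !comp_assoc, natκ, Hη, <- comp_assoc, Hη. apply nat.
  - intros D D' g. apply ext.
    rewrite !hom_of_comp, <- !comp_assoc, Hε, <- nat, comp_assoc, Hε. apply natκ.
  - intros A. apply ext.
    rewrite hom_of_comp, <- comp_assoc, <- nat, comp_assoc, Hε, Hη.
    symmetry; apply comp_id_l.
  - intros D. apply (lift_unique (cκ _)).
    rewrite hom_of_comp, comp_assoc, natκ, <- comp_assoc, Hη, Hε.
    symmetry; apply comp_id_r.
Qed.

Section Adjunctions.
Context {E B : Category} {p : Functor E B} (c : Cleavage p) {X Y : B} (f : Hom X Y).

Definition colift_unit (L : Functor (fibre p X) (fibre p Y))
    (adj : Adjunction L (reindex c f)) (A : fibre p X) :
    HomOver f A (L A : fibre p Y) :=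
  comp_over (cart c f (L A : fibre p Y)) (adj_unit adj A) (comp_id_r f).

Lemma cart_reindex (A A' : ObOver p Y) (v : HomOver (id Y) A A') :
  cart c f A' ∘ reindex_map c f v = v ∘ cart c f A.
Proof. unfold reindex_map. now rewrite lift_comp. Qed.

Lemma colift_unit_transpose (L : Functor (fibre p X) (fibre p Y))
    (adj : Adjunction L (reindex c f)) (A : fibre p X) (D : fibre p Y)
    (v : Hom A (reindex c f D)) :
  hom_of (adj_counit adj D ∘ fmap L v) ∘ colift_unit adj A = cart c f D ∘ hom_of v.
Proof.
  (* The chase is done with arbitrary arrows of [E]: composites in a fibre agree with those of [E]
     only by conversion, which hinders rewriting. *)
  assert (T : forall (a b d e g h : E) (ε : Hom d g) (Lv : Hom b d) (κ1 : Hom e b)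
    (κ2 : Hom h d) (η : Hom a e) (rLv : Hom e h) (k : E) (κ3 : Hom k g) (rε : Hom h k)
    (ηR : Hom k h) (v : Hom a k), κ2 ∘ rLv = Lv ∘ κ1 -> κ3 ∘ rε = ε ∘ κ2 ->
    ηR ∘ v = rLv ∘ η -> rε ∘ ηR = id k -> (ε ∘ Lv) ∘ (κ1 ∘ η) = κ3 ∘ v).
  { intros a b d e g h ε Lv κ1 κ2 η rLv k κ3 rε ηR w e1 e2 e3 e4.
    rewrite <- comp_assoc, (comp_assoc Lv), <- e1, <- (comp_assoc κ2), <- e3.
    rewrite (comp_assoc κ2), comp_assoc, (comp_assoc ε), <- e2, <- (comp_assoc κ3), e4.
    now rewrite comp_id_r. }
  exact (T _ _ _ _ _ _ _ _ _ _ _ _ _ _ _ _ _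
    (cart_reindex (fmap L v)) (cart_reindex (adj_counit adj D))
    (f_equal (@hom_of _ _ _ _ _ _ _ _) (unit_natural adj v))
    (f_equal (@hom_of _ _ _ _ _ _ _ _) (triangle_r adj D))).
Qed.

Lemma colift_unit_natural (L : Functor (fibre p X) (fibre p Y))
    (adj : Adjunction L (reindex c f)) (A A' : fibre p X) (v : Hom A A') :
  colift_unit adj A' ∘ hom_of v = hom_of (fmap L v) ∘ colift_unit adj A.
Proof.
  assert (T : forall (a a' b b' d d' : E) (κ : Hom b d) (κ' : Hom b' d') (η : Hom a b)
    (η' : Hom a' b') (v : Hom a a') (r : Hom b b') (l : Hom d d'),
    κ' ∘ r = l ∘ κ -> η' ∘ v = r ∘ η -> (κ' ∘ η') ∘ v = l ∘ (κ ∘ η)).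
  { intros a a' b b' d d' κ κ' η η' w r l e1 e2.
    now rewrite <- comp_assoc, e2, comp_assoc, e1, comp_assoc. }
  exact (T _ _ _ _ _ _ _ _ _ _ _ _ _ (cart_reindex (fmap L v))
    (f_equal (@hom_of _ _ _ _ _ _ _ _) (unit_natural adj v))).
Qed.

(** The adjunction gives the universal property against arrows over [f]; that this suffices uses the
    cleavage, through [locally_cocartesian]. *)
Lemma colift_unit_cocartesian (L : Functor (fibre p X) (fibre p Y))
    (adj : Adjunction L (reindex c f)) (A : fibre p X) :
  is_cocartesian p (colift_unit adj A).
Proof.
  apply (locally_cocartesian c). intros D ψ.
  pose (v := lift (cart_cartesian c f D) ψ (comp_id_r f) :
    @Hom (fibre p X) A (reindex c f D)).
  exists (adj_counit adj D ∘ fmap L v : @Hom (fibre p Y) _ _). split.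
  - rewrite colift_unit_transpose. apply lift_comp.
  - intros χ e. f_equal.
    assert (v = fmap (reindex c f) (χ : @Hom (fibre p Y) _ _) ∘ adj_unit adj A) as ->.
    { apply (lift_unique (cart_cartesian c f D)). unfold v; rewrite lift_comp, <- e.
      change (χ ∘ (cart c f (L A) ∘ adj_unit adj A) =
        cart c f D ∘ (reindex_map c f χ ∘ adj_unit adj A)).
      now rewrite !comp_assoc, cart_reindex. }
    rewrite fmap_comp, comp_assoc, counit_natural, <- comp_assoc, triangle_l.
    symmetry; apply (comp_id_r (χ : @Hom (fibre p Y) _ _)).
Qed.

Lemma cocartesian_adjunction (L : Functor (fibre p X) (fibre p Y))
    (φ : forall A : fibre p X, HomOver f A (L A : fibre p Y)) :
  (forall A : fibre p X, is_cocartesian p (φ A)) ->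
  (forall (A A' : fibre p X) (v : Hom A A'),
     φ A' ∘ hom_of v = hom_of (fmap L v) ∘ φ A) ->
  inhabited (Adjunction L (reindex c f)).
Proof.
  intros cφ nat.
  exact (cocartesian_cartesian_adjunction (R := reindex c f) (fun D => cart_cartesian c f D)
    (fun D D' v => cart_reindex v) cφ nat).
Qed.

Lemma cocartesian_lifts_adjunction :
  (forall A : ObOver p X, exists (A' : ObOver p Y) (φ : HomOver f A A'),
     is_cocartesian p φ) ->
  exists L : Functor (fibre p X) (fibre p Y), inhabited (Adjunction L (reindex c f)).
Proof.
  intros H.
  assert (HL : forall A : ObOver p X,
    {A' : ObOver p Y & {φ : HomOver f A A' | is_cocartesian p φ}}).
  { intros A. destruct (constructive_indefinite_description _ (H A)) as [A' h].
    exists A'. now apply constructive_indefinite_description. }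
  pose (ob := fun A => projT1 (HL A)).
  pose (φ := fun A => proj1_sig (projT2 (HL A)) : HomOver f A (ob A)).
  assert (cφ : forall A, is_cocartesian p (φ A)) by exact (fun A => proj2_sig (projT2 (HL A))).
  clearbody φ. clearbody ob.
  assert (HM : forall (A A' : fibre p X) (v : Hom A A'),
    {w : HomOver (id Y) (ob A) (ob A') | w ∘ φ A = φ A' ∘ hom_of v}).
  { intros A A' v. apply constructive_indefinite_description.
    apply (colift_exists (cφ A) (comp_over (φ A') v (comp_id_r f)) (comp_id_l f)). }
  pose (map := fun A A' (v : @Hom (fibre p X) A A') => proj1_sig (HM A A' v)).
  assert (Hmap : forall A A' (v : @Hom (fibre p X) A A'),
    map A A' v ∘ φ A = φ A' ∘ hom_of v) by exact (fun A A' v => proj2_sig (HM A A' v)).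
  assert (ext : forall (A : ObOver p X) (D : ObOver p Y) (u v : HomOver (id Y) (ob A) D),
    hom_of u ∘ φ A = hom_of v ∘ φ A -> u = v).
  { intros A D u v e. apply hom_over_eq. exact (over_cocartesian_ext (cφ A) (hom_over u)
    (hom_over v) eq_refl e). }
  unshelve eexists (@Build_Functor (fibre p X) (fibre p Y) ob map _ _).
  - intros A. apply ext. rewrite Hmap; simpl. now rewrite comp_id_l, comp_id_r.
  - intros A A' A'' v u. apply ext. simpl.
    rewrite Hmap, <- comp_assoc, Hmap, !comp_assoc, Hmap. simpl. now rewrite !comp_assoc.
  - match goal with |- inhabited (Adjunction ?L _) =>
      apply (@cocartesian_adjunction L φ cφ) end.
    intros A A' v; simpl. symmetry; apply Hmap.
Qed.

End Adjunctions.

Ltac solve_over := repeat first [apply hom_over | apply is_over_id | eapply over_comp].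

Ltac drop_id := etransitivity; [|symmetry; apply comp_id_r].

Ltac solve_base :=
  simpl;
  unfold times_ll, times_l, times, pr_1_1, pr_1_2_2, pr_1_2, pr_2_3, pr_1_3, pr_2_4,
    pr_1_2_1_2;
  repeat match goal with |- @eq (Hom _ (product _ _ _)) _ _ => apply pairing_ext end;
  repeat (rewrite <- comp_assoc || rewrite π1_pairing_comp || rewrite π2_pairing_comp ||
    rewrite π1_pairing || rewrite π2_pairing || rewrite comp_id_l || rewrite comp_id_r);
  try reflexivity.

(** * Path objects and path induction *)

Section Paths.
Context {E B : Category} {p : Functor E B} {c : Cleavage p} (P : FibredFiniteProducts c).

Local Notation "X × Y" := (product (base_prod P) X Y) (at level 40, left associativity).
Local Notation pr_1 := (π1 (base_prod P)).
Local Notation pr_2 := (π2 (base_prod P)).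
Local Notation "⟨ f , g ⟩" := (pairing (base_prod P) f g) (at level 0).
Local Notation over X := (ObOver p X).
Local Notation "f ^* A" := (reindex_ob c f A) (at level 30, right associativity).
Local Notation "⊤" := (top P).
Local Notation "A ⊓ A'" := (meet P A A') (at level 45, left associativity).
Local Notation cartc := (cart_cartesian c).

Lemma pr1_pairing_over (X Y : B) (f : Hom X Y) (A : over X) (A1 A2 : over Y)
    (ψ1 : HomOver f A A1) (ψ2 : HomOver f A A2) :
  meet_pr1 P A1 A2 ∘ pairing_over P ψ1 ψ2 = ψ1.
Proof. unfold pairing_over. now destruct constructive_definite_description as [χ [? ?]]. Qed.

Lemma pr2_pairing_over (X Y : B) (f : Hom X Y) (A : over X) (A1 A2 : over Y)
    (ψ1 : HomOver f A A1) (ψ2 : HomOver f A A2) :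
  meet_pr2 P A1 A2 ∘ pairing_over P ψ1 ψ2 = ψ2.
Proof. unfold pairing_over. now destruct constructive_definite_description as [χ [? ?]]. Qed.

Lemma meet_ext (X Y : B) (f f' : Hom X Y) (A : over X) (A1 A2 : over Y)
    (χ χ' : Hom A (A1 ⊓ A2)) :
  is_over f χ -> is_over f' χ' -> f = f' ->
  meet_pr1 P A1 A2 ∘ χ = meet_pr1 P A1 A2 ∘ χ' ->
  meet_pr2 P A1 A2 ∘ χ = meet_pr2 P A1 A2 ∘ χ' -> χ = χ'.
Proof.
  intros o o' e. subst f'. intros e1 e2.
  destruct (meet_over_exists P (comp_over (meet_pr1 P A1 A2) (Build_HomOver o) (comp_id_l f))
    (comp_over (meet_pr2 P A1 A2) (Build_HomOver o) (comp_id_l f))) as [χ0 [_ u]].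
  transitivity (hom_of χ0); [symmetry|];
    [apply (f_equal (@hom_of _ _ _ _ _ _ _ _) (u (Build_HomOver o) (conj eq_refl eq_refl)))|].
  apply (f_equal (@hom_of _ _ _ _ _ _ _ _)
    (u (Build_HomOver o') (conj (eq_sym e1) (eq_sym e2)))).
Qed.

Lemma top_ext (X Y : B) (f f' : Hom X Y) (A : over X) (χ χ' : Hom A (⊤ Y)) :
  is_over f χ -> is_over f' χ' -> f = f' -> χ = χ'.
Proof.
  intros o o' e. subst f'. destruct (top_over_exists P f A) as [χ0 [_ u]].
  transitivity (hom_of χ0); [symmetry|].
  - exact (f_equal (@hom_of _ _ _ _ _ _ _ _) (u (Build_HomOver o) I)).
  - exact (f_equal (@hom_of _ _ _ _ _ _ _ _) (u (Build_HomOver o') I)).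
Qed.

Lemma meet_map_cartesian (X Y : B) (f : Hom X Y) (A1 A2 : over X) (B1 B2 : over Y)
    (φ1 : HomOver f A1 B1) (φ2 : HomOver f A2 B2) :
  is_cartesian p φ1 -> is_cartesian p φ2 -> is_cartesian p (meet_map P φ1 φ2).
Proof.
  intros c1 c2. apply over_cartesian. intros W h D ψ.
  pose (ψ1 := comp_over (meet_pr1 P B1 B2) ψ (comp_id_l _)).
  pose (ψ2 := comp_over (meet_pr2 P B1 B2) ψ (comp_id_l _)).
  exists (pairing_over P (lift c1 ψ1 eq_refl) (lift c2 ψ2 eq_refl)). split.
  - eapply meet_ext; [solve_over|solve_over|reflexivity| |];
      rewrite comp_assoc; unfold meet_map;
      rewrite ?pr1_pairing_over, ?pr2_pairing_over; simpl;
      rewrite <- comp_assoc, ?pr1_pairing_over, ?pr2_pairing_over; apply lift_comp.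
  - intros χ e. eapply meet_ext; [solve_over|solve_over|reflexivity| |];
      rewrite ?pr1_pairing_over, ?pr2_pairing_over.
    + eapply (over_cartesian_ext c1); [solve_over|solve_over|apply comp_id_l|].
      rewrite lift_comp; unfold ψ1; simpl. rewrite <- e, comp_assoc. unfold meet_map.
      now rewrite (comp_assoc (meet_pr1 P B1 B2)), pr1_pairing_over.
    + eapply (over_cartesian_ext c2); [solve_over|solve_over|apply comp_id_l|].
      rewrite lift_comp; unfold ψ2; simpl. rewrite <- e, comp_assoc. unfold meet_map.
      now rewrite (comp_assoc (meet_pr2 P B1 B2)), pr2_pairing_over.
Qed.

Section PathObject.
Context {S X : B} (x : Hom S X) (I : over (X × X)).

Definition ends : Hom (S × X) (X × X) := ⟨x ∘ pr_1, pr_2⟩.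
Definition point : Hom S (S × X) := ⟨id S, x⟩.

(* In the internal language, [path_ob A] consists of the [(s, y, a, q)] with [a : A s] and
   [q : I (x s, y)]; [base_elt] and [path_elt] extract [a] and [q], and [pack] forms the pair of
   two generalised elements. *)
Definition path_ob (A : over S) : over (S × X) := (pr_1 ^* A) ⊓ (ends ^* I).

Definition base_elt (A : over S) : HomOver pr_1 (path_ob A) A :=
  comp_over (cart c pr_1 A) (meet_pr1 P _ _) (comp_id_r pr_1).

Definition path_elt (A : over S) : HomOver ends (path_ob A) I :=
  comp_over (cart c ends I) (meet_pr2 P _ _) (comp_id_r ends).

Definition pack {W : B} {G : over W} {A : over S} (l : Hom W (S × X)) {m : Hom W S}
    {n : Hom W (X × X)} (a : HomOver m G A) (q : HomOver n G I)
    (em : pr_1 ∘ l = m) (en : ends ∘ l = n) : HomOver l G (path_ob A) :=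
  pairing_over P (lift (cartc pr_1 A) a em) (lift (cartc ends I) q en).

Lemma base_pack (W : B) (G : over W) (A : over S) (l : Hom W (S × X)) (m : Hom W S)
    (n : Hom W (X × X)) (a : HomOver m G A) (q : HomOver n G I)
    (em : pr_1 ∘ l = m) (en : ends ∘ l = n) :
  base_elt A ∘ pack a q em en = a.
Proof. simpl. unfold pack. rewrite <- comp_assoc, pr1_pairing_over. apply lift_comp. Qed.

Lemma path_pack (W : B) (G : over W) (A : over S) (l : Hom W (S × X)) (m : Hom W S)
    (n : Hom W (X × X)) (a : HomOver m G A) (q : HomOver n G I)
    (em : pr_1 ∘ l = m) (en : ends ∘ l = n) :
  path_elt A ∘ pack a q em en = q.
Proof. simpl. unfold pack. rewrite <- comp_assoc, pr2_pairing_over. apply lift_comp. Qed.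

Lemma base_pack_comp (W : B) (G : over W) (A : over S) (l : Hom W (S × X)) (m : Hom W S)
    (n : Hom W (X × X)) (a : HomOver m G A) (q : HomOver n G I)
    (em : pr_1 ∘ l = m) (en : ends ∘ l = n) (G' : E) (g : Hom G' G) :
  base_elt A ∘ (pack a q em en ∘ g) = a ∘ g.
Proof. now rewrite comp_assoc, base_pack. Qed.

Lemma path_pack_comp (W : B) (G : over W) (A : over S) (l : Hom W (S × X)) (m : Hom W S)
    (n : Hom W (X × X)) (a : HomOver m G A) (q : HomOver n G I)
    (em : pr_1 ∘ l = m) (en : ends ∘ l = n) (G' : E) (g : Hom G' G) :
  path_elt A ∘ (pack a q em en ∘ g) = q ∘ g.
Proof. now rewrite comp_assoc, path_pack. Qed.

Lemma path_ob_ext (W : B) (G : over W) (A : over S) (l l' : Hom W (S × X))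
    (χ χ' : Hom G (path_ob A)) :
  is_over l χ -> is_over l' χ' -> l = l' ->
  base_elt A ∘ χ = base_elt A ∘ χ' -> path_elt A ∘ χ = path_elt A ∘ χ' -> χ = χ'.
Proof.
  intros o o' e eb ep. eapply meet_ext; [exact o|exact o'|exact e| |].
  - eapply (over_cartesian_ext (cartc pr_1 A)).
    + eapply over_comp; [apply hom_over|exact o].
    + eapply over_comp; [apply hom_over|exact o'].
    + now rewrite e.
    + now rewrite !comp_assoc.
  - eapply (over_cartesian_ext (cartc ends I)).
    + eapply over_comp; [apply hom_over|exact o].
    + eapply over_comp; [apply hom_over|exact o'].
    + now rewrite e.
    + now rewrite !comp_assoc.
Qed.

Lemma ends_point : ends ∘ point = ⟨x, x⟩.
Proof. unfold ends, point. solve_base. Qed.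

Lemma pr_1_point : pr_1 ∘ point = id S.
Proof. unfold point. solve_base. Qed.

Context (k : HomOver ⟨x, x⟩ (⊤ S) I).

Definition refl_path (A : over S) : HomOver point A (path_ob A) :=
  pack (id_over A) (comp_over k (bang_over P (id S) A) (comp_id_r _)) pr_1_point ends_point.

(** An arrow out of [path_ob x I A] may be prescribed, uniquely, on the pairs [(a, k)]. The
    parameter [A] makes this stronger than cocartesianness of [k] itself. *)
Definition path_induction : Prop :=
  forall A : over S, is_cocartesian p (refl_path A).

Lemma base_refl (A : over S) : base_elt A ∘ refl_path A = id (ob_of A).
Proof. apply base_pack. Qed.

Lemma path_refl (A : over S) : path_elt A ∘ refl_path A = k ∘ bang_over P (id S) A.
Proof. apply path_pack. Qed.

End PathObject.

Arguments ends {S X} x.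
Arguments point {S X} x.
Arguments path_ob {S X} x I A.
Arguments base_elt {S X} x I A.
Arguments path_elt {S X} x I A.

(** For [A = ⊤] the first factor of the path object is terminal, so that the path object is just the
    reindexing of [I]. *)
Lemma refl_path_top_iso (S X : B) (x : Hom S X) (I : over (X × X))
    (k : HomOver ⟨x, x⟩ (⊤ S) I) :
  path_induction k -> is_cocartesian p (lift (cartc (ends x) I) k (ends_point x)).
Proof.
  intros H.
  pose (β := pack (x := x) (bang_over P pr_1 (ends x ^* I)) (cart c (ends x) I)
    (comp_id_r pr_1) (comp_id_r (ends x))).
  eapply (cocartesian_iso_square (α := id _) (β := β)); [apply iso_id| | |apply H].
  - exists (meet_pr2 P _ _). split.
    + eapply (over_cartesian_ext (cartc (ends x) I)); [solve_over|solve_over|solve_base|].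
      rewrite comp_id_r, comp_assoc. apply path_pack.
    + eapply path_ob_ext; [solve_over|solve_over|solve_base| |].
      * eapply top_ext; [solve_over|solve_over|solve_base].
      * unfold β. rewrite path_pack_comp. symmetry; apply comp_id_r.
  - eapply path_ob_ext; [solve_over|solve_over|solve_base| |].
    + eapply top_ext; [solve_over|solve_over|solve_base].
    + unfold β. rewrite path_pack_comp, lift_comp, comp_id_r, path_refl.
      assert (hom_of (bang_over P (id S) (⊤ S)) = id _) as ->.
      { eapply top_ext; [solve_over|solve_over|reflexivity]. }
      now rewrite comp_id_r.
Qed.

Opaque base_elt path_elt.

(** * Every section over the diagonal satisfies path induction *)

Section AnyLoop.
Context {U X : B} (I : over (X × X)).

Local Notation S := (U × X).
Local Notation x := (@π2 _ (base_prod P) U X).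
Local Notation x' := (x ∘ @π1 _ (base_prod P) (U × X) X).

Context (k : HomOver ⟨x, x⟩ (⊤ S) I) (k' : HomOver ⟨x', x'⟩ (⊤ (S × X)) I).
Context (Hk : path_induction k) (Hk' : path_induction k').

Local Notation A2 := (ends x ^* I).
Let q : HomOver (ends x) A2 I := cart c (ends x) I.
Local Notation J := (path_ob x' I A2).
(* [A2] consists of the paths [q : x s ~ y], and [J] of the pairs of paths [q1 : x s ~ y] and
   [q2 : x s ~ w]. *)
Let q1 : HomOver (ends x ∘ pr_1) J I := comp_over q (base_elt x' I A2) eq_refl.
Let q2 : HomOver (ends x') J I := path_elt x' I A2.

Let ι (h : HomOver ⟨x, x⟩ (⊤ S) I) : HomOver (point x) (⊤ S) A2 :=
  lift (cartc (ends x) I) h (ends_point x).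

Local Lemma q_ι (h : HomOver ⟨x, x⟩ (⊤ S) I) : q ∘ ι h = h.
Proof. apply lift_comp. Qed.

Local Lemma q_ext (W : B) (G : over W) (l l' : Hom W (S × X)) (χ χ' : Hom G A2) :
  is_over l χ -> is_over l' χ' -> l = l' -> q ∘ χ = q ∘ χ' -> χ = χ'.
Proof. apply over_cartesian_ext, cartc. Qed.

Local Lemma J_ext (W : B) (G : over W) (l l' : Hom W (S × X × X)) (χ χ' : Hom G J) :
  is_over l χ -> is_over l' χ' -> l = l' -> q1 ∘ χ = q1 ∘ χ' -> q2 ∘ χ = q2 ∘ χ' -> χ = χ'.
Proof.
  intros o o' e e1 e2. eapply path_ob_ext; [exact o|exact o'|exact e| |exact e2].
  eapply q_ext; [eapply over_comp; [apply hom_over|exact o]|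
                 eapply over_comp; [apply hom_over|exact o']|now rewrite e|].
  now rewrite !comp_assoc.
Qed.

Let mkJ {W : B} {G : over W} (l : Hom W (S × X × X)) {n1 n2 : Hom W (X × X)}
    (a : HomOver n1 G I) (b : HomOver n2 G I)
    (e1 : ends x ∘ (pr_1 ∘ l) = n1) (e2 : ends x' ∘ l = n2) : HomOver l G J :=
  pack (x := x') (A := A2) (lift (cartc (ends x) I) a e1) b eq_refl e2.

Local Lemma q1_mkJ (W : B) (G : over W) (l : Hom W (S × X × X)) (n1 n2 : Hom W (X × X))
    (a : HomOver n1 G I) (b : HomOver n2 G I)
    (e1 : ends x ∘ (pr_1 ∘ l) = n1) (e2 : ends x' ∘ l = n2) :
  q1 ∘ mkJ a b e1 e2 = a.
Proof.
  change (q ∘ base_elt x' I A2 ∘ mkJ a b e1 e2 = a). unfold mkJ.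
  rewrite <- comp_assoc, base_pack. apply lift_comp.
Qed.

Local Lemma q2_mkJ (W : B) (G : over W) (l : Hom W (S × X × X)) (n1 n2 : Hom W (X × X))
    (a : HomOver n1 G I) (b : HomOver n2 G I)
    (e1 : ends x ∘ (pr_1 ∘ l) = n1) (e2 : ends x' ∘ l = n2) :
  q2 ∘ mkJ a b e1 e2 = b.
Proof. apply path_pack. Qed.

Let J0 : HomOver (point x' ∘ point x) (⊤ S) J := comp_over (refl_path k' A2) (ι k) eq_refl.

(** The value of [k'] at [(s, x s)]. Nothing relates it to [k], although [J0] is the pair
    [(k, κ)]. *)
Let κ : HomOver ⟨x, x⟩ (⊤ S) I.
Proof.
  refine (comp_over k' (bang_over P (point x) (⊤ S)) _). unfold point. solve_base.
Defined.

Local Lemma cι : is_cocartesian p (ι k).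
Proof. now apply refl_path_top_iso. Qed.

Local Lemma cJ0 : is_cocartesian p J0.
Proof. apply cocartesian_comp; [apply Hk'|apply cι]. Qed.

Local Lemma q1_J0 : q1 ∘ J0 = k.
Proof.
  unfold q1, J0; simpl hom_of.
  change (q ∘ base_elt x' I A2 ∘ (refl_path k' A2 ∘ ι k) = k).
  now rewrite <- comp_assoc, (comp_assoc (base_elt x' I A2)), base_refl, comp_id_l, q_ι.
Qed.

Local Lemma q2_J0 : q2 ∘ J0 = κ.
Proof.
  unfold q2, J0, κ; simpl hom_of.
  change (path_elt x' I A2 ∘ (refl_path k' A2 ∘ ι k) = k' ∘ bang_over P (point x) (⊤ S)).
  rewrite comp_assoc, path_refl, <- comp_assoc. f_equal.
  eapply top_ext; [solve_over|solve_over|solve_base].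
Qed.

Local Lemma bang_id (g : Hom (⊤ S) (⊤ S)) (f : Hom S S) : is_over f g -> f = id S -> g = id _.
Proof. intros o e. eapply top_ext; [exact o|solve_over|exact e]. Qed.

(* [κ] is the image of [k] under an arrow [m] that has a section, so it determines arrows out
   of [A2] just as [k] does. *)
Local Lemma κ_epic (Z : B) (D : over Z) (h h' : Hom (S × X) Z) (f f' : Hom A2 D) :
  is_over h f -> is_over h' f' -> h = h' -> f ∘ ι κ = f' ∘ ι κ -> f = f'.
Proof.
  intros o o' e ef.
  (* [Φ] turns q1 : x s ~ y and q2 : x s ~ w into a path x s ~ w, with Φ(k, κ) = k. Since m(k) = κ,
     induction gives m(Φ(q1, q2)) = q2, and q ↦ Φ(q, q) is the section of [m]. *)
  destruct (colift_exists (h := ⟨x' ∘ pr_1, pr_2⟩) cJ0 k) as [Φ eΦ].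
  { unfold point. solve_base. }
  destruct (colift_exists (h := ends x) cι κ) as [m em].
  { unfold point, ends. solve_base. }
  unshelve epose (Φ2 := lift (h := ⟨pr_1 ∘ pr_1, pr_2⟩) (cartc (ends x) I) Φ _ : HomOver _ J A2).
  { unfold ends. solve_base. }
  assert (C1 : m ∘ Φ2 = q2).
  { eapply (over_cocartesian_ext cJ0); [solve_over|solve_over|unfold ends; solve_base|].
    rewrite <- comp_assoc, q2_J0, <- em. f_equal.
    eapply q_ext; [solve_over|solve_over|unfold point; solve_base|].
    rewrite comp_assoc, q_ι. unfold Φ2, q. now rewrite lift_comp. }
  unshelve epose (w := mkJ (l := ⟨id _, pr_2⟩) q q _ _).
  1, 2: unfold ends; solve_base.
  pose (m2 := lift (h := id _) (cartc (ends x) I) m (comp_id_r _) : HomOver _ A2 A2).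
  assert (em2 : q ∘ m2 = m) by apply lift_comp.
  assert (mw : m2 ∘ (Φ2 ∘ w) = id (ob_of A2)).
  { eapply q_ext; [solve_over|solve_over|unfold ends; solve_base|].
    rewrite comp_assoc, em2, comp_assoc, C1, comp_id_r. apply q2_mkJ. }
  assert (fm : f ∘ m2 = f' ∘ m2).
  { eapply (over_cocartesian_ext cι).
    - eapply over_comp; [exact o|solve_over].
    - eapply over_comp; [exact o'|solve_over].
    - now rewrite e.
    - assert (m2 ∘ ι k = ι κ) as em3.
      { eapply q_ext; [solve_over|solve_over|solve_base|].
        now rewrite comp_assoc, em2, em, q_ι. }
      now rewrite <- !comp_assoc, em3. }
  rewrite <- (comp_id_r f), <- (comp_id_r f'), <- mw.
  now rewrite !comp_assoc, fm.
Qed.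

(** A vertical automorphism [R] of [A2] with R(k) = h carries [refl_path k] to [refl_path h]; the
    proof manufactures [R] from reversals of paths. *)
Lemma path_induction_any (h : HomOver ⟨x, x⟩ (⊤ S) I) : path_induction h.
Proof.
  destruct (colift_exists (h := ⟨pr_2 ∘ pr_1, pr_2⟩) cJ0 κ) as [d ed].
  { unfold point. solve_base. }
  (* [d] sends the paths [q1 : x s ~ y] and [q2 : x s ~ w] to the composite [y ~ w]; by [C3] it
     has [k] as a left unit. *)
  assert (C3 : forall (g : HomOver ⟨x, x⟩ (⊤ S) I) (l : Hom S (S × X × X)) (χ : Hom (⊤ S) J),
    is_over l χ -> l = point x' ∘ point x -> q1 ∘ χ = k -> q2 ∘ χ = g -> d ∘ χ = g).
  { intros g l χ o el e1 e2.
    unshelve epose (s := mkJ (l := ⟨⟨pr_1, x'⟩, pr_2⟩)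
      (comp_over k (bang_over P pr_1 A2) eq_refl) q _ _).
    1, 2: unfold ends; solve_base.
    assert (es : d ∘ s = q).
    { eapply κ_epic; [solve_over|solve_over|unfold ends; solve_base|].
      rewrite <- comp_assoc, q_ι, <- ed. f_equal.
      eapply J_ext; [solve_over|solve_over|unfold point; solve_base| |].
      - rewrite comp_assoc. unfold s. rewrite q1_mkJ, q1_J0. simpl hom_of.
        rewrite <- comp_assoc, (@bang_id _ (pr_1 ∘ point x)), comp_id_r; auto.
        + solve_over.
        + unfold point. solve_base.
      - rewrite comp_assoc. unfold s. now rewrite q2_mkJ, q2_J0, q_ι. }
    transitivity (d ∘ (s ∘ ι g)); [f_equal|now rewrite comp_assoc, es, q_ι].
    eapply J_ext; [exact o|solve_over|rewrite el; unfold point; solve_base| |].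
    - rewrite e1, comp_assoc. unfold s. rewrite q1_mkJ. simpl hom_of.
      rewrite <- comp_assoc, (@bang_id _ (pr_1 ∘ point x)), comp_id_r; auto.
      + solve_over.
      + unfold point. solve_base.
    - rewrite e2, comp_assoc. unfold s. now rewrite q2_mkJ, q_ι. }
  (* The map (u, x, y) ↦ (u, y). That [S] is a product with [X] matters here: the end of a path is
     again a point of [S], at which [k] gives a loop. *)
  pose (r := ⟨pr_1 ∘ pr_1, pr_2⟩ : Hom (S × X) S).
  unshelve epose (s := mkJ (l := ⟨id _, pr_2⟩) q q _ _).
  1, 2: unfold ends; solve_base.
  assert (C4 : d ∘ s = k ∘ bang_over P r A2).
  { eapply (over_cocartesian_ext cι); [solve_over|solve_over|unfold r; solve_base|].
    rewrite <- !comp_assoc, (@bang_id _ (r ∘ point x)), comp_id_r.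
    - eapply C3; [solve_over|unfold point; solve_base| |]; rewrite comp_assoc; unfold s.
      + now rewrite q1_mkJ, q_ι.
      + now rewrite q2_mkJ, q_ι.
    - solve_over.
    - unfold r, point. solve_base. }
  pose (sw := ⟨r, pr_2 ∘ pr_1⟩ : Hom (S × X) (S × X)).
  (* [N] sends q : x s ~ y to d(q, g) : y ~ x s. Hence N(k) = d(k, g) = g by [C3], and N(g) = d(g,
     g) = k by [C4]. *)
  assert (C5 : forall g : HomOver ⟨x, x⟩ (⊤ S) I, exists N : HomOver sw A2 A2,
    N ∘ ι k = ι g /\ N ∘ ι g = ι k).
  { intros g.
    unshelve epose (t := mkJ (l := ⟨id _, pr_2 ∘ pr_1⟩) q
      (comp_over g (bang_over P pr_1 A2) eq_refl) _ _).
    1, 2: unfold ends; solve_base.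
    unshelve epose (N := lift (h := sw) (cartc (ends x) I)
      (comp_over d t eq_refl) _ : HomOver _ A2 A2).
    { unfold sw, r, ends. solve_base. }
    assert (eN : q ∘ N = d ∘ t) by apply lift_comp.
    assert (b : forall f : HomOver ⟨x, x⟩ (⊤ S) I, bang_over P pr_1 A2 ∘ ι f = id _).
    { intros f. eapply bang_id; [solve_over|unfold point; solve_base]. }
    exists N; split; (eapply q_ext; [solve_over|solve_over|unfold sw, r, point; solve_base|]);
      rewrite comp_assoc, eN, q_ι, <- comp_assoc.
    - eapply C3; [solve_over|unfold point; solve_base| |]; rewrite comp_assoc; unfold t.
      + now rewrite q1_mkJ, q_ι.
      + rewrite q2_mkJ. simpl hom_of. now rewrite <- comp_assoc, b, comp_id_r.
    - transitivity (d ∘ s ∘ ι g).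
      + rewrite <- comp_assoc. f_equal.
        eapply J_ext; [solve_over|solve_over|unfold point; solve_base| |];
          rewrite !comp_assoc; unfold s, t.
        * now rewrite !q1_mkJ.
        * rewrite !q2_mkJ. simpl hom_of. now rewrite <- comp_assoc, b, comp_id_r, q_ι.
      + rewrite C4, <- comp_assoc, (@bang_id _ (r ∘ point x)), comp_id_r; auto.
        * solve_over.
        * unfold r, point. solve_base. }
  assert (SW : sw ∘ sw = id _) by (unfold sw, r; solve_base).
  assert (C6 : forall N : HomOver sw A2 A2, N ∘ (N ∘ ι k) = ι k -> N ∘ N = id (ob_of A2)).
  { intros N e. eapply (over_cocartesian_ext cι); [solve_over|solve_over|exact SW|].
    now rewrite <- comp_assoc, e, comp_id_l. }
  (* [M] is the ordinary reversal, which fixes [k]. Both [N] and [M] lie over [sw], so their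
     composite is vertical; it sends [k] to [h]. *)
  destruct (C5 h) as [N [e1 e2]], (C5 k) as [M [e3 _]].
  pose (R := comp_over N M SW).
  assert (iR : is_iso (hom_of R)).
  { apply iso_comp.
    - exists N; split; apply C6; now rewrite e1.
    - exists M; split; apply C6; now rewrite e3. }
  intros A.
  pose (β := meet_map P (id_over (pr_1 ^* A)) R : HomOver (id _) (path_ob x I A) (path_ob x I A)).
  assert (B1 : meet_pr1 P _ _ ∘ β = meet_pr1 P _ _).
  { unfold β, meet_map. rewrite pr1_pairing_over. apply comp_id_l. }
  assert (B2 : meet_pr2 P _ _ ∘ β = R ∘ meet_pr2 P _ _).
  { unfold β, meet_map. now rewrite pr2_pairing_over. }
  assert (T : forall g : HomOver ⟨x, x⟩ (⊤ S) I,
    meet_pr2 P _ _ ∘ refl_path g A = ι g ∘ bang_over P (id S) A).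
  { intros g. unfold refl_path, pack. rewrite pr2_pairing_over.
    eapply q_ext; [solve_over|solve_over|symmetry; apply comp_id_r|].
    rewrite comp_assoc, q_ι. apply lift_comp. }
  assert (β ∘ refl_path k A = refl_path h A) as <-.
  { eapply meet_ext; [solve_over|solve_over|solve_base| |]; rewrite comp_assoc.
    - transitivity (meet_pr1 P _ _ ∘ refl_path k A).
      + exact (f_equal (fun z => z ∘ hom_of (refl_path k A)) B1).
      + unfold refl_path, pack. now rewrite !pr1_pairing_over.
    - transitivity (R ∘ meet_pr2 P _ _ ∘ refl_path k A).
      + exact (f_equal (fun z => z ∘ hom_of (refl_path k A)) B2).
      + rewrite <- comp_assoc. etransitivity; [exact (f_equal (fun z => R ∘ z) (T k))|].
        etransitivity; [|symmetry; exact (T h)]. rewrite comp_assoc. f_equal.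
        change (N ∘ M ∘ ι k = ι h). now rewrite <- comp_assoc, e3, e1. }
  apply cocartesian_comp; [|apply Hk].
  (* A meet of isomorphisms is cartesian, and a cartesian arrow over an identity is invertible. *)
  apply iso_cocartesian, cartesian_over_iso; [|apply iso_id].
  apply meet_map_cartesian; apply iso_cartesian; [apply iso_id|exact iR].
Qed.

End AnyLoop.

Local Notation assoc := (@comp_assoc E _ _ _ _).
Local Notation idl := (@comp_id_l E _ _).
Local Notation idr := (@comp_id_r E _ _).

Lemma hom_comp_over (X Y Z : B) (f : Hom X Y) (g : Hom Y Z) (h : Hom X Z)
    (A : over X) (A' : over Y) (A'' : over Z) (ψ : HomOver g A' A'') (φ : HomOver f A A')
    (e : g ∘ f = h) :
  hom_of (comp_over ψ φ e) = ψ ∘ φ.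
Proof. reflexivity. Qed.

(** [Xi] and [transport_functor] use other cartesian lifts, over [pr_1_2] and [pr_2_3]; these base
    arrows equal [pr_1] and [ends x] only provably, whence the equations [e1] and [e2]. *)
Lemma path_ob_compare (S X : B) (x : Hom S X) (I : over (X × X)) (A : over S)
    (f1 : Hom (S × X) S) (f2 : Hom (S × X) (X × X)) (C D : over (S × X))
    (ρ : HomOver f1 C A) (β : HomOver f2 D I) (e1 : pr_1 = f1) (e2 : ends x = f2) :
  is_cartesian p ρ -> is_cartesian p β ->
  exists i : HomOver (id (S × X)) (C ⊓ D) (path_ob x I A),
    is_iso (hom_of i) /\
    base_elt x I A ∘ i = ρ ∘ meet_pr1 P C D /\ path_elt x I A ∘ i = β ∘ meet_pr2 P C D.
Proof.
  intros cρ cβ. subst f1 f2.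
  exists (pack (l := id _) (comp_over ρ (meet_pr1 P C D) (comp_id_r _))
    (comp_over β (meet_pr2 P C D) (comp_id_r _)) (comp_id_r _) (comp_id_r _)).
  split; [|split; [apply base_pack|apply path_pack]].
  exists (pairing_over P (lift cρ (base_elt x I A) (comp_id_r _))
    (lift cβ (path_elt x I A) (comp_id_r _))). split.
  - eapply meet_ext; [solve_over|solve_over|solve_base| |]; rewrite assoc; drop_id.
    + rewrite pr1_pairing_over.
      eapply (over_cartesian_ext cρ); [solve_over|solve_over|solve_base|].
      now rewrite assoc, lift_comp, base_pack.
    + rewrite pr2_pairing_over.
      eapply (over_cartesian_ext cβ); [solve_over|solve_over|solve_base|].
      now rewrite assoc, lift_comp, path_pack.
  - eapply path_ob_ext; [solve_over|solve_over|solve_base| |];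
      drop_id; rewrite assoc, ?base_pack, ?path_pack, hom_comp_over, <- assoc.
    + now rewrite pr1_pairing_over, lift_comp.
    + now rewrite pr2_pairing_over, lift_comp.
Qed.

Lemma times_r_iso (S S' X : B) (i : Hom S' S) (j : Hom S S') :
  i ∘ j = id S -> times (base_prod P) i (id X) ∘ times (base_prod P) j (id X) = id _.
Proof.
  intros e. unfold times. solve_base. now rewrite comp_assoc, e, comp_id_l.
Qed.

(** Allows parameters to be permuted and a factor 1 to be added or removed, so that path induction
    for the last projection yields it for other base points. *)
Lemma path_induction_transfer (S S' X : B) (i : Hom S' S) (x : Hom S X) (x' : Hom S' X)
    (I : over (X × X)) (k : HomOver ⟨x, x⟩ (⊤ S) I) (k' : HomOver ⟨x', x'⟩ (⊤ S') I) :
  is_iso i -> x ∘ i = x' -> hom_of k' = k ∘ bang_over P i (⊤ S') ->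
  path_induction k -> path_induction k'.
Proof.
  intros [j [ji ij]] e ek H A. subst x'.
  pose (γ := cart c j A). pose (α := lift (cartc j A) (id_over A) ji).
  assert (γα : γ ∘ α = id (ob_of A)) by apply lift_comp.
  assert (αγ : α ∘ γ = id (ob_of (j ^* A))).
  { eapply (over_cartesian_ext (cartc j A)); [solve_over|solve_over|exact ij|].
    fold γ. now rewrite assoc, γα, idl, idr. }
  assert (xij : (x ∘ i) ∘ j = x) by now rewrite <- comp_assoc, ij, comp_id_r.
  unshelve epose (β := pack (x := x) (l := times (base_prod P) i (id X))
    (comp_over α (base_elt (x ∘ i) I A) eq_refl) (path_elt (x ∘ i) I A) _ _).
  1, 2: unfold ends; solve_base.
  unshelve epose (δ := pack (x := x ∘ i) (l := times (base_prod P) j (id X))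
    (comp_over γ (base_elt x I (j ^* A)) eq_refl) (path_elt x I (j ^* A)) _ _).
  1, 2: unfold ends; solve_base; now rewrite (comp_assoc i), ij, comp_id_l.
  apply (cocartesian_iso_square (φ := refl_path k (j ^* A)) (α := α) (β := β)).
  - now exists γ.
  - exists δ; split; (eapply path_ob_ext; [solve_over|solve_over|now apply times_r_iso| |]);
      drop_id; unfold β, δ; rewrite ?base_pack_comp, ?path_pack_comp, ?hom_comp_over,
        <- ?assoc, ?base_pack, ?path_pack; [|reflexivity| |reflexivity].
    + now rewrite hom_comp_over, assoc, γα, idl.
    + now rewrite hom_comp_over, assoc, αγ, idl.
  - eapply path_ob_ext; [solve_over|solve_over|unfold point; solve_base| |];
      unfold β; rewrite ?base_pack_comp, ?path_pack_comp, (assoc _ _ α).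
    + now rewrite hom_comp_over, <- assoc, !base_refl, idl, idr.
    + rewrite !path_refl, ek, <- !assoc. f_equal.
      eapply top_ext; [solve_over|solve_over|solve_base].
  - apply H.
Qed.

(** * The class Ξ and path induction for a fixed loop *)

Section LoopPaths.
Context {X : B} (L : Loop P X).

Lemma loop_refl_over (S : B) (x : Hom S X) : pr_1_1 (base_prod P) X ∘ x = ⟨x, x⟩.
Proof. solve_base. Qed.

Definition loop_refl {S : B} (x : Hom S X) : HomOver ⟨x, x⟩ (⊤ S) (loop_ob L) :=
  comp_over (loop_arr L) (bang_over P x (⊤ S)) (loop_refl_over x).

Definition loop_induction : Prop :=
  forall U : B, path_induction (loop_refl (@π2 _ (base_prod P) U X)).

Lemma loop_refl_comp (S S' : B) (x : Hom S X) (i : Hom S' S) (A : over S') :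
  loop_refl x ∘ bang_over P i A = loop_arr L ∘ bang_over P (x ∘ i) A.
Proof.
  unfold loop_refl. rewrite hom_comp_over, <- assoc. f_equal.
  eapply top_ext; [solve_over|solve_over|reflexivity].
Qed.

Lemma loop_induction_transfer (S U : B) (i : Hom S (U × X)) (x : Hom S X) :
  loop_induction -> is_iso i -> pr_2 ∘ i = x -> path_induction (loop_refl x).
Proof.
  intros H ii e. eapply (path_induction_transfer ii e); [|apply H].
  rewrite loop_refl_comp, e. reflexivity.
Qed.

(** In σ ∧ φ' the domain of φ' is cartesian over a terminal object, hence terminal in its fibre, and
    the first projection of the domain is an isomorphism. *)
Lemma Xi_refl_path (A A' : E) (φ : Hom A A') :
  Xi L φ ->
  exists (U : B) (C : over (U × X)) (α : Hom A C) (β : Hom A' (path_ob pr_2 (loop_ob L) C)),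
    is_iso α /\ is_iso β /\ β ∘ φ = refl_path (loop_refl pr_2) C ∘ α.
Proof.
  intros [U A1 D1 φ' α β C C' ρ σ cα cβ eφ cρ cσ eρ].
  destruct (@path_ob_compare _ _ pr_2 (loop_ob L) C _ _ C' D1 ρ β) as [i [ii [i1 i2]]];
    [solve_base|unfold ends; solve_base|exact cρ|exact cβ|].
  exists U, C, (meet_pr1 P C A1), i. split; [|split; [exact ii|]].
  - exists (pairing_over P (id_over C)
      (lift cα (bang_over P pr_2 C) (comp_id_r _))). split; [|apply pr1_pairing_over].
    eapply meet_ext; [solve_over|solve_over|solve_base| |]; rewrite assoc; drop_id.
    + rewrite pr1_pairing_over. apply comp_id_l.
    + rewrite pr2_pairing_over.
      eapply (over_cartesian_ext cα); [solve_over|solve_over|solve_base|].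
      eapply top_ext; [solve_over|solve_over|solve_base].
  - eapply path_ob_ext; [solve_over|solve_over|unfold point; solve_base| |];
      rewrite !assoc.
    + rewrite base_refl, i1, idl, <- assoc. unfold meet_map.
      now rewrite pr1_pairing_over, hom_comp_over, assoc, eρ, idl.
    + rewrite path_refl, i2, <- assoc. unfold meet_map.
      rewrite pr2_pairing_over, hom_comp_over, assoc, eφ, loop_refl_comp, <- !assoc.
      f_equal. eapply top_ext; [solve_over|solve_over|solve_base].
Qed.

Lemma refl_path_Xi (U : B) (C : over (U × X)) :
  exists (A A' : E) (φ : Hom A A') (α : Hom (ob_of C) A)
    (β : Hom (ob_of (path_ob pr_2 (loop_ob L) C)) A'),
    Xi L φ /\ is_iso α /\ is_iso β /\ β ∘ refl_path (loop_refl pr_2) C = φ ∘ α.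
Proof.
  unshelve epose (φ' := lift (h := pr_1_2_2 (base_prod P) U X) (cartc (pr_2_3
    (base_prod P) U X X) (loop_ob L))
    (comp_over (loop_arr L) (cart c (@π2 _ (base_prod P) U X) (⊤ X)) eq_refl) _).
  { solve_base. }
  unshelve epose (σ := lift (h := pr_1_2_2 (base_prod P) U X) (cartc (pr_1_2 (base_prod P) U X X) C)
    (id_over C) _).
  { solve_base. }
  assert (eσ : cart c (pr_1_2 (base_prod P) U X X) C ∘ σ = id (ob_of C)) by apply lift_comp.
  assert (Q : Xi L (meet_map P σ φ')).
  { eapply Xi_intro; [apply cartc|apply cartc|apply lift_comp|apply cartc| |exact eσ].
    (* Both ρ and ρσ = id are cartesian, hence so is σ. *)
    apply (cartesian_cancel (cartc (pr_1_2 (base_prod P) U X X) C)).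
    eapply eq_ind_r; [|exact eσ]. apply iso_cartesian, iso_id. }
  destruct (@path_ob_compare _ _ pr_2 (loop_ob L) C _ _ _ _ (cart c (pr_1_2 (base_prod P) U X X) C)
    (cart c (pr_2_3 (base_prod P) U X X) (loop_ob L))) as [i [[i' [ii1 ii2]] [i1 i2]]];
    [solve_base|unfold ends; solve_base|apply cartc|apply cartc|].
  exists _, _, (hom_of (meet_map P σ φ')).
  exists (hom_of (pairing_over P (id_over C)
    (lift (cartc (@π2 _ (base_prod P) U X) (⊤ X)) (bang_over P pr_2 C) (comp_id_r _)))).
  exists i'. split; [exact Q|]. split; [|split; [now exists i|]].
  - exists (meet_pr1 P C _). split; [apply pr1_pairing_over|].
    eapply meet_ext; [solve_over|solve_over|solve_base| |]; rewrite assoc; drop_id.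
    + rewrite pr1_pairing_over. apply comp_id_l.
    + rewrite pr2_pairing_over.
      eapply (over_cartesian_ext (cartc _ _)); [solve_over|solve_over|solve_base|].
      eapply top_ext; [solve_over|solve_over|solve_base].
  - match goal with |- _ = _ ∘ hom_of ?a => set (α := a) end.
    transitivity (i' ∘ (i ∘ (meet_map P σ φ' ∘ α)));
      [|now rewrite assoc, ii1, idl].
    f_equal. eapply path_ob_ext; [solve_over|solve_over|unfold point; solve_base| |];
      rewrite !assoc.
    + rewrite base_refl, i1, <- (assoc (cart c _ _)). unfold meet_map.
      rewrite pr1_pairing_over, hom_comp_over, assoc, eσ, idl.
      unfold α. now rewrite pr1_pairing_over.
    + rewrite path_refl, i2, <- (assoc (cart c _ _)). unfold meet_map.
      rewrite pr2_pairing_over, hom_comp_over, assoc. unfold φ'. rewrite lift_comp.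
      rewrite hom_comp_over, loop_refl_comp, <- !assoc. f_equal.
      eapply top_ext; [solve_over|solve_over|solve_base].
Qed.

Lemma Xi_cocartesian :
  (forall (A A' : E) (φ : Hom A A'), Xi L φ -> is_cocartesian p φ) <-> loop_induction.
Proof.
  split.
  - intros H U C. destruct (refl_path_Xi C) as [A [A' [φ [α [β [Q [iα [iβ e]]]]]]]].
    eapply cocartesian_iso_square; [exact iα|exact iβ|exact e|now apply H].
  - intros H A A' φ Q.
    destruct (Xi_refl_path Q) as [U [C [α [β [iα [iβ e]]]]]].
    eapply cocartesian_iso_square; [exact iα|exact iβ|exact e|apply H].
Qed.

End LoopPaths.

Lemma one_ext (A : B) (f g : Hom A (one (base_prod P))) : f = g.
Proof.
  destruct (one_terminal (base_prod P) A) as [t u]. now rewrite (u f), (u g).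
Qed.

Lemma one_map (A : B) : inhabited (Hom A (one (base_prod P))).
Proof. destruct (one_terminal (base_prod P) A) as [t _]. now constructor. Qed.

Lemma bang_over_id (S : B) (f : Hom S S) : f = id S -> hom_of (bang_over P f (⊤ S)) = id _.
Proof. intros ->. eapply top_ext; [solve_over|solve_over|reflexivity]. Qed.

Lemma loop_refl_id (X : B) (L : Loop P X) : hom_of (loop_refl L (id X)) = loop_arr L.
Proof. unfold loop_refl. rewrite hom_comp_over, bang_over_id; [apply idr|reflexivity]. Qed.

(** Induction with no further variables: X ≅ 1 × X. *)
Lemma loop_induction_id (X : B) (L : Loop P X) :
  loop_induction L -> path_induction (loop_refl L (id X)).
Proof.
  intros H. destruct (one_map X) as [t].
  apply (@loop_induction_transfer _ L _ (one (base_prod P)) ⟨t, id X⟩); [exact H| |solve_base].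
  exists pr_2. split; [solve_base|]. solve_base. apply one_ext.
Qed.

(** For [x = id X] the arrow [ends x] is an identity, so the cartesian arrow through which [∂_X]
    factors is invertible. *)
Lemma loop_induction_cocartesian (X : B) (L : Loop P X) :
  loop_induction L -> is_cocartesian p (loop_arr L).
Proof.
  intros H. pose proof (refl_path_top_iso (loop_induction_id H)) as H'.
  rewrite <- loop_refl_id, <- (lift_comp (cartc (ends (id X)) (loop_ob L)) (loop_refl L (id X))
    (ends_point (id X))).
  apply cocartesian_comp; [|exact H'].
  apply iso_cocartesian, cartesian_over_iso; [apply cartc|].
  assert (ends (id X) = id _) as -> by (unfold ends; solve_base). apply iso_id.
Qed.

(** * Transport, inverse paths and products of loops *)

Section Transport.
Context {X : B} (L : Loop P X) (H : loop_induction L).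

(** With [K] itself as parameter, the identity of [K] extends to a transport of K(s, y) to K(s, z)
    along a path y ~ z. *)
Lemma transport_exists (S : B) (K : over (S × X)) :
  exists t : HomOver ⟨pr_1 ∘ pr_1, pr_2⟩ (path_ob pr_2 (loop_ob L) K) K,
    t ∘ refl_path (loop_refl L pr_2) K = id (ob_of K).
Proof.
  destruct (colift_exists (h := ⟨pr_1 ∘ pr_1, pr_2⟩) (@H S K) (id_over K)) as [t e].
  { unfold point. solve_base. }
  now exists t.
Qed.

Lemma inverse_exists :
  exists v : HomOver ⟨pr_2, pr_1⟩ (loop_ob L) (loop_ob L),
    v ∘ loop_arr L = loop_arr L /\ v ∘ v = id (ob_of (loop_ob L)).
Proof.
  pose proof (loop_induction_cocartesian H) as cd.
  destruct (colift_exists (h := ⟨pr_2, pr_1⟩) cd (loop_arr L)) as [v e]; [solve_base|].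
  exists v. split; [exact e|].
  eapply (over_cocartesian_ext cd); [solve_over|solve_over|solve_base|].
  now rewrite <- assoc, !e, idl.
Qed.

Lemma carrier_exists (A : over X) : exists t : Carrier L A, strict t.
Proof.
  destruct (colift_exists (h := pr_2) (@loop_induction_id _ _ H A) (id_over A)) as [τ e].
  { unfold point. solve_base. }
  unshelve epose (q := pack (x := id X) (I := loop_ob L) (l := id _)
    (comp_over (cart c pr_1 A) (meet_pr1 P (pr_1 ^* A) (loop_ob L)) (comp_id_r _))
    (meet_pr2 P (pr_1 ^* A) (loop_ob L)) (comp_id_r _) _).
  { unfold ends. solve_base. }
  exists (comp_over τ q (comp_id_r _)). unfold strict.
  transitivity (τ ∘ refl_path (loop_refl L (id X)) A); [|exact e].
  rewrite hom_comp_over, <- assoc. f_equal.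
  eapply path_ob_ext; [solve_over|solve_over|unfold point; solve_base| |].
  - unfold q. rewrite base_pack_comp, base_refl, hom_comp_over, <- assoc.
    unfold delta, diag_lift. rewrite pr1_pairing_over. apply lift_comp.
  - unfold q. rewrite path_pack_comp, path_refl. unfold delta.
    rewrite pr2_pairing_over, loop_refl_id. reflexivity.
Qed.

End Transport.

(** Induction in the coordinate X, then in Y with the paths in X as parameter: the composite of the
    two reflexivity arrows is cocartesian, and [∂_{X × Y}] extends along it. *)
Lemma box_exists (L : forall X : B, Loop P X) :
  (forall X : B, loop_induction (L X)) ->
  forall X Y : B, exists χ : HomOver (id (X × Y × (X × Y)))
      (box (loop_ob (L X)) (loop_ob (L Y))) (loop_ob (L (X × Y))),
    hom_of χ ∘ box_loop (L X) (L Y) = loop_arr (L (X × Y)).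
Proof.
  intros H X Y.
  pose (x := @π1 _ (base_prod P) X Y).
  pose (y := @π2 _ (base_prod P) X Y ∘ @π1 _ (base_prod P) (X × Y) X).
  assert (Hx : path_induction (loop_refl (L X) x)).
  { apply (@loop_induction_transfer _ _ _ Y ⟨pr_2, pr_1⟩); [apply H| |unfold x; solve_base].
    exists ⟨pr_2, pr_1⟩. split; solve_base. }
  assert (Hy : path_induction (loop_refl (L Y) y)).
  { apply (@loop_induction_transfer _ _ _ (X × X) ⟨⟨pr_1 ∘ pr_1, pr_2⟩, pr_2 ∘ pr_1⟩);
      [apply H| |unfold y; solve_base].
    exists ⟨⟨pr_1 ∘ pr_1, pr_2⟩, pr_2 ∘ pr_1⟩. split; solve_base. }
  pose (T1 := path_ob x (loop_ob (L X)) (⊤ (X × Y))).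
  pose (r1 := refl_path (loop_refl (L X) x) (⊤ (X × Y)) : HomOver _ _ T1).
  pose (r2 := refl_path (loop_refl (L Y) y) T1).
  pose proof (cocartesian_comp (Hy T1) (Hx (⊤ (X × Y)))) as cr.
  pose (h := ⟨pr_1 ∘ pr_1, ⟨pr_2 ∘ pr_1, pr_2⟩⟩ : Hom (X × Y × X × Y) (X × Y × (X × Y))).
  destruct (colift_exists (φ := comp_over r2 r1 eq_refl) (h := h) cr (loop_arr (L (X × Y))))
    as [f ef].
  { unfold h, point, x, y. solve_base. }
  pose (IX := loop_ob (L X)). pose (IY := loop_ob (L Y)).
  pose (l1 := ⟨pr_1, pr_1 ∘ pr_2⟩ : Hom (X × Y × (X × Y)) (X × Y × X)).
  pose (l2 := ⟨l1, pr_2 ∘ pr_2⟩ : Hom (X × Y × (X × Y)) (X × Y × X × Y)).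
  (* [q1] and [q2] rearrange a pair of paths over ((x, y), (x', y')) into the iterated path object
     over (x, y, x', y'). *)
  unshelve epose (q1 := pack (x := x) (I := IX) (A := ⊤ (X × Y)) (l := l1) (bang_over P pr_1
    (box IX IY))
    (comp_over (cart c (pr_1_3 (base_prod P) X Y) IX) (meet_pr1 P _ _) (comp_id_r _)) _ _).
  1, 2: unfold ends, l1, x; solve_base.
  unshelve epose (q2 := pack (x := y) (I := IY) (A := T1) (l := l2) q1
    (comp_over (cart c (pr_2_4 (base_prod P) X Y) IY) (meet_pr2 P _ _) (comp_id_r _)) _ _).
  1, 2: unfold ends, l2, l1, y; solve_base.
  unshelve eexists (comp_over f q2 _).
  { unfold h, l2, l1. solve_base. }
  rewrite hom_comp_over, <- assoc, <- ef. f_equal.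
  eapply path_ob_ext; [solve_over|solve_over|unfold l2, l1, point, x, y; solve_base| |].
  - unfold q2. rewrite base_pack_comp, hom_comp_over, assoc. unfold r2.
    rewrite base_refl, idl.
    eapply path_ob_ext; [solve_over|solve_over|unfold l1, point, x; solve_base| |].
    + eapply top_ext; [solve_over|solve_over|unfold l1, point, x; solve_base].
    + unfold q1, r1, T1. rewrite path_pack_comp, path_refl, hom_comp_over, <- assoc.
      unfold box_loop, IX, IY, box. rewrite pr1_pairing_over, lift_comp, loop_refl_comp,
        hom_comp_over.
      f_equal. eapply top_ext; [solve_over|solve_over|solve_base].
  - unfold q2. rewrite path_pack_comp, hom_comp_over, hom_comp_over, assoc. unfold r2.
    rewrite path_refl, <- assoc.
    unfold box_loop, IX, IY, box. rewrite pr2_pairing_over, lift_comp, loop_refl_comp,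
      hom_comp_over.
    rewrite <- assoc. f_equal.
    eapply top_ext; [solve_over|solve_over|unfold y, point, x; solve_base].
Qed.

Lemma locally_epic_loop_induction (T : forall X : B, StrictTransporter P X) :
  productive T ->
  (forall (X : B) (A A' : E) (φ : Hom A A'), Xi (tr_loop (T X)) φ -> locally_epic p φ) ->
  forall X : B, loop_induction (tr_loop (T X)).
Proof.
  intros HT HE X U.
  pose (L := tr_loop (T X)). pose (x := @π2 _ (base_prod P) U X).
  change (path_induction (loop_refl L x)). intros A.
  assert (le : locally_epic p (refl_path (loop_refl L x) A)).
  { destruct (refl_path_Xi L A) as [D [D' [φ [α [β [Q [iα [iβ e]]]]]]]].
    eapply locally_epic_iso_square; [exact iα|exact iβ|exact e|now apply (HE X)]. }
  apply (locally_cocartesian c). intros D ψ.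
  destruct (HT (U × X) X) as [χ eχ].
  (* The map (u, x, y) ↦ ((u, x, x), (u, x, y)): ψ(a) lies at the first point and is to be
     transported to the second. *)
  pose (l := ⟨point x ∘ pr_1, id (U × X × X)⟩ : Hom (U × X × X) ((U × X × X) × (U × X × X))).
  unshelve epose (e1 := lift (h := l) (cartc (pr_1_3 (base_prod P) (U × X) X) (loop_ob (tr_loop
    (T (U × X)))))
    (comp_over (loop_arr (tr_loop (T (U × X)))) (bang_over P pr_1 (path_ob x
      (loop_ob L) A)) eq_refl) _).
  { unfold l, point. solve_base. }
  unshelve epose (e2 := lift (h := l) (cartc (pr_2_4 (base_prod P) (U × X) X) (loop_ob L))
    (path_elt x (loop_ob L) A) _).
  { unfold l, point, ends. solve_base. }
  pose (e3 := comp_over χ (pairing_over P e1 e2) (comp_id_l l)).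
  unshelve epose (d1 := lift (h := l) (cartc pr_1 D) (comp_over ψ (base_elt x
    (loop_ob L) A) eq_refl) _).
  { unfold l. solve_base. }
  unshelve epose (v := comp_over (tr_carrier (T (U × X × X)) D)
    (pairing_over P d1 e3) _ : HomOver (id _) (path_ob x (loop_ob L) A) D).
  { unfold l. solve_base. }
  exists v.
  (* At q = ∂ the path used is χ(∂, ∂) = ∂, so the carrier is applied to [delta] of ψ, and
     strictness returns ψ. *)
  assert (ev : v ∘ refl_path (loop_refl L x) A = ψ).
  { transitivity (tr_carrier (T (U × X × X)) D ∘ (delta (tr_loop (T (U × X × X))) D ∘ ψ));
      [|rewrite assoc; etransitivity; [exact (f_equal (fun z => z ∘ hom_of ψ) (tr_strict (T
        (U × X × X)) D))
         |apply idl]].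
    unfold v. rewrite hom_comp_over, <- assoc. f_equal.
    eapply meet_ext; [solve_over|solve_over|unfold l, point; solve_base| |]; rewrite !assoc.
    - rewrite pr1_pairing_over. unfold delta, diag_lift. rewrite pr1_pairing_over.
      eapply (over_cartesian_ext (cartc pr_1 D));
        [solve_over|solve_over|unfold l, point; solve_base|].
      rewrite !assoc, lift_comp. unfold d1. rewrite lift_comp, hom_comp_over, <- assoc, base_refl.
      rewrite idr. symmetry; apply idl.
    - rewrite pr2_pairing_over. unfold delta. rewrite pr2_pairing_over. unfold e3.
      rewrite !hom_comp_over.
      rewrite <- (eχ : χ ∘ _ = loop_arr (tr_loop (T (U × X × X)))), <- !assoc. f_equal.
      eapply meet_ext; [solve_over|solve_over|unfold l, point; solve_base| |]; rewrite !assoc.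
      + unfold box_loop. rewrite !pr1_pairing_over.
        eapply (over_cartesian_ext (cartc _ _)); [solve_over|solve_over|unfold l, point;
          solve_base|].
        rewrite !assoc. unfold e1. rewrite !lift_comp, !hom_comp_over, <- !assoc. f_equal.
        eapply top_ext; [solve_over|solve_over|unfold point; solve_base].
      + unfold box_loop. rewrite !pr2_pairing_over.
        eapply (over_cartesian_ext (cartc _ _)); [solve_over|solve_over|unfold l, point;
          solve_base|].
        rewrite !assoc. unfold e2. rewrite !lift_comp, path_refl, !hom_comp_over, loop_refl_comp.
        rewrite <- !assoc. f_equal.
        eapply top_ext; [solve_over|solve_over|unfold point, x; solve_base]. }
  split; [exact ev|]. intros v' ev'.
  eapply (over_locally_epic_ext le); [solve_over|solve_over|reflexivity|].
  now rewrite ev, ev'.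
Qed.

(** * The class of cocartesian arrows over Δ *)

Lemma over_Delta_intro (U X : B) (A : over (U × X)) (D : over (U × X × X))
    (φ : HomOver (pr_1_2_2 (base_prod P) U X) A D) : over_Delta P φ.
Proof. exists U, X, (ob_over A), (ob_over D). apply hom_over. Qed.

Lemma pairable_intro :
  (forall (U X : B) (A : over (U × X)) (D : over (U × X × X))
     (φ : HomOver (pr_1_2_2 (base_prod P) U X) A D) (K' : over (U × X))
     (K : over (U × X × X)) (ψ : HomOver (pr_1_2_2 (base_prod P) U X) K' K),
     is_cocartesian p φ -> is_cartesian p ψ -> is_cocartesian p (meet_map P φ ψ)) ->
  pairable P (cocartesian_over_Delta P).
Proof.
  intros H X0 Y0 f A D φ K' K ψ [cφ [U [X [eA [eD e]]]]] cψ.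
  (* Membership over Δ speaks of [p A] and [p D], while [φ] lies over [f]; through [ob_over] this
     becomes an identification of [f] that can be substituted. *)
  assert (Q : exists (eX : X0 = U × X) (eY : Y0 = U × X × X),
    hom_cast eX eY f = pr_1_2_2 (base_prod P) U X).
  { destruct A as [A hA], D as [D hD], φ as [φ hφ]; simpl in *. unfold is_over in hφ.
    simpl in hφ. subst X0 Y0. exists eA, eD. now rewrite <- hφ. }
  clear eA eD e. destruct Q as [eX [eY e]]. subst X0 Y0. simpl in e. subst f.
  split; [now apply H|apply over_Delta_intro].
Qed.

Lemma meet_swap_iso (Y : B) (A1 A2 B1 B2 : over Y) (a1 : HomOver (id Y) A1 B1)
    (a2 : HomOver (id Y) A2 B2) :
  is_iso (hom_of a1) -> is_iso (hom_of a2) ->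
  is_iso (hom_of (pairing_over P (comp_over a2 (meet_pr2 P A1 A2) (comp_id_r _))
    (comp_over a1 (meet_pr1 P A1 A2) (comp_id_r _)))).
Proof.
  intros i1 i2.
  apply vertical_iso in i1, i2. destruct i1 as [b1 [e1 e1']], i2 as [b2 [e2 e2']].
  apply (f_equal (@hom_of _ _ _ _ _ _ _ _)) in e1, e1', e2, e2'.
  exists (hom_of (pairing_over P (comp_over (b1 : HomOver (id Y) _ _) (meet_pr2 P B2 B1)
    (comp_id_r _))
    (comp_over (b2 : HomOver (id Y) _ _) (meet_pr1 P B2 B1) (comp_id_r _)))).
  split; (eapply meet_ext; [solve_over|solve_over|solve_base| |]); drop_id; rewrite assoc;
    rewrite ?pr1_pairing_over, ?pr2_pairing_over, hom_comp_over, <- assoc,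
      ?pr1_pairing_over, ?pr2_pairing_over, hom_comp_over, assoc.
  - etransitivity; [exact (f_equal (fun z => z ∘ hom_of (meet_pr1 P A1 A2)) e1)|apply idl].
  - etransitivity; [exact (f_equal (fun z => z ∘ hom_of (meet_pr2 P A1 A2)) e2)|apply idl].
  - etransitivity; [exact (f_equal (fun z => z ∘ hom_of (meet_pr1 P B2 B1)) e2')|apply idl].
  - etransitivity; [exact (f_equal (fun z => z ∘ hom_of (meet_pr2 P B2 B1)) e1')|apply idl].
Qed.

(** Pairability puts the cocartesian factor first, whereas Frobenius reciprocity and Ξ put it
    second. *)
Lemma meet_map_swap_cocartesian (X Y : B) (f : Hom X Y) (A1 A2 A1' A2' : over X)
    (B1 B2 B1' B2' : over Y) (φ1 : HomOver f A1 B1) (φ2 : HomOver f A2 B2)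
    (φ1' : HomOver f A1' B1') (φ2' : HomOver f A2' B2')
    (a1 : HomOver (id X) A1' A1) (a2 : HomOver (id X) A2' A2)
    (b1 : HomOver (id Y) B1' B1) (b2 : HomOver (id Y) B2' B2) :
  is_iso (hom_of a1) -> is_iso (hom_of a2) -> is_iso (hom_of b1) -> is_iso (hom_of b2) ->
  b1 ∘ φ1' = φ1 ∘ a1 -> b2 ∘ φ2' = φ2 ∘ a2 ->
  is_cocartesian p (meet_map P φ1 φ2) -> is_cocartesian p (meet_map P φ2' φ1').
Proof.
  intros ia1 ia2 ib1 ib2 e1 e2.
  eapply cocartesian_iso_square; [exact (meet_swap_iso ia2 ia1)|exact (meet_swap_iso ib2 ib1)|].
  unfold meet_map.
  eapply meet_ext; [solve_over|solve_over|solve_base| |]; rewrite !assoc;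
    rewrite ?pr1_pairing_over, ?pr2_pairing_over, !hom_comp_over, <- !assoc,
      ?pr1_pairing_over, ?pr2_pairing_over, !hom_comp_over, !assoc; now f_equal.
Qed.

Lemma cocartesian_comparison (X Y : B) (f : Hom X Y) (A : over X) (D D' : over Y)
    (φ : HomOver f A D) (φ' : HomOver f A D') :
  is_cocartesian p φ -> is_cocartesian p φ' ->
  exists i : HomOver (id Y) D D', is_iso (hom_of i) /\ i ∘ φ = φ'.
Proof.
  intros cφ cφ'. destruct (colift_exists cφ φ' (comp_id_l f)) as [i ei].
  exists i; split; [|exact ei]. exact (cocartesian_compare_iso cφ cφ' ei).
Qed.

Lemma cartesian_comparison (X Y : B) (f : Hom X Y) (A A' : over X) (D : over Y)
    (φ : HomOver f A D) (φ' : HomOver f A' D) :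
  is_cartesian p φ -> is_cartesian p φ' ->
  exists i : HomOver (id X) A A', is_iso (hom_of i) /\ φ' ∘ i = φ.
Proof.
  intros cφ cφ'. exists (lift cφ' φ (comp_id_r f)).
  assert (e : φ' ∘ lift cφ' φ (comp_id_r f) = φ) by apply lift_comp.
  split; [|exact e]. exact (cartesian_compare_iso cφ cφ' e).
Qed.

Lemma meet_pr1_pairing (X : B) (A A1 A2 : fibre p X) (u : Hom A A1) (v : Hom A A2) :
  meet_pr1 P A1 A2 ∘ hom_of (pairing (fibre_prod P X) u v) = hom_of u.
Proof. exact (f_equal (@hom_of E B p X X (id X) A A1) (π1_pairing (fibre_prod P X) u v)). Qed.

Lemma meet_pr2_pairing (X : B) (A A1 A2 : fibre p X) (u : Hom A A1) (v : Hom A A2) :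
  meet_pr2 P A1 A2 ∘ hom_of (pairing (fibre_prod P X) u v) = hom_of v.
Proof. exact (f_equal (@hom_of E B p X X (id X) A A2) (π2_pairing (fibre_prod P X) u v)). Qed.

(** * Frobenius reciprocity and Beck-Chevalley in terms of cocartesian arrows *)

Section Mates.
Context (Ex : forall Y X : B, Functor (fibre p (Y × X)) (fibre p (Y × X × X)))
        (adj : forall Y X : B, Adjunction (Ex Y X) (reindex c (pr_1_2_2 (base_prod P) Y X))).

Lemma unit_over_cocartesian (Y X : B) (A : over (Y × X)) :
  is_cocartesian p (unit_over adj A).
Proof. exact (colift_unit_cocartesian (adj := adj Y X) (A := A)). Qed.

(** The unit is cocartesian, so a vertical arrow out of [Ex Y X A] compares two cocartesian arrows
    exactly when it is invertible. Both canonical arrows are handled this way. *)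
Lemma mate_iso (Y X : B) (A : over (Y × X)) (D : over (Y × X × X))
    (χ : @Hom (fibre p (Y × X × X)) (Ex Y X A) D)
    (φ : HomOver (pr_1_2_2 (base_prod P) Y X) A D) :
  hom_of χ ∘ unit_over adj A = φ -> (is_iso χ <-> is_cocartesian p φ).
Proof.
  intros e. rewrite <- (vertical_iso (χ : HomOver (id _) (Ex Y X A) D)). split.
  - intros i. rewrite <- e. apply cocartesian_comp; [now apply iso_cocartesian|].
    apply unit_over_cocartesian.
  - intros cφ. exact (cocartesian_compare_iso (@unit_over_cocartesian _ _ A) cφ e).
Qed.

Lemma frobenius_unit (Y X : B) (A : fibre p (Y × X)) (D : fibre p (Y × X × X)) :
  hom_of (frobenius_arrow adj A D) ∘
    unit_over adj ((pr_1_2_2 (base_prod P) Y X ^* D) ⊓ A) =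
  meet_map P (cart c (pr_1_2_2 (base_prod P) Y X) D) (unit_over adj A).
Proof.
  pose (R := reindex c (pr_1_2_2 (base_prod P) Y X) D).
  pose (u := adj_counit (adj Y X) D ∘
    fmap (Ex Y X) (π1 (fibre_prod P (Y × X)) (A := R) (B := A))).
  pose (v := fmap (Ex Y X) (π2 (fibre_prod P (Y × X)) (A := R) (B := A))).
  pose proof (meet_pr1_pairing u v) as q1. pose proof (meet_pr2_pairing u v) as q2.
  unfold meet_map. eapply meet_ext.
  - eapply over_comp; [exact (hom_over (frobenius_arrow adj A D : HomOver
    (id _) _ _))|apply hom_over].
  - apply hom_over.
  - apply comp_id_l.
  - rewrite pr1_pairing_over, assoc.
    etransitivity; [exact (f_equal (fun z => z ∘ hom_of (unit_over adj _)) q1)|].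
    exact (colift_unit_transpose (adj Y X) (D := D) (π1 (fibre_prod P (Y × X)))).
  - rewrite pr2_pairing_over, assoc.
    etransitivity; [exact (f_equal (fun z => z ∘ hom_of (unit_over adj _)) q2)|].
    symmetry. exact (colift_unit_natural (adj Y X) (π2 (fibre_prod P (Y × X)))).
Qed.

Lemma beck_chevalley_unit (Y Z : B) (f : Hom Y Z) (X : B) (A : over (Z × X)) :
  hom_of (beck_chevalley_arrow adj f A) ∘ unit_over adj (times_l (base_prod P) f X ^* A) =
  beck_chevalley_over adj f A.
Proof.
  etransitivity; [apply (colift_unit_transpose (adj Y X))|]. apply lift_comp.
Qed.

Lemma frobenius_iff :
  frobenius_reciprocity adj <->
  forall (Y X : B) (A : over (Y × X)) (D : over (Y × X × X)),
    is_cocartesian p (meet_map P (cart c (pr_1_2_2 (base_prod P) Y X) D) (unit_over adj A)).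
Proof.
  split; intros H Y X A D; apply (mate_iso (frobenius_unit A D)), H.
Qed.

Lemma beck_chevalley_iff :
  beck_chevalley adj <->
  forall (Y Z : B) (f : Hom Y Z) (X : B) (A : over (Z × X)),
    is_cocartesian p (beck_chevalley_over adj f A).
Proof.
  split; intros H Y Z f X A; apply (mate_iso (beck_chevalley_unit f A)), H.
Qed.

Lemma frobenius_pairable :
  frobenius_reciprocity adj -> pairable P (cocartesian_over_Delta P).
Proof.
  intros H. apply pairable_intro. intros U X A D φ K' K ψ cφ cψ.
  destruct (cocartesian_comparison cφ (@unit_over_cocartesian _ _ A)) as [i [ii ei]].
  destruct (cartesian_comparison cψ (cartc (pr_1_2_2 (base_prod P) U X) K)) as [j [ij ej]].
  eapply (meet_map_swap_cocartesian (φ1 := cart c (pr_1_2_2 (base_prod P) U X) K)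
    (φ2 := unit_over adj A) (a1 := j) (a2 := id_over A) (b1 := id_over K) (b2 := i));
    [exact ij|apply iso_id|apply iso_id|exact ii|rewrite ej; apply idl| |].
  - rewrite ei. symmetry; apply idr.
  - now apply frobenius_iff.
Qed.

Lemma pairable_frobenius :
  pairable P (cocartesian_over_Delta P) -> frobenius_reciprocity adj.
Proof.
  intros H. apply frobenius_iff. intros U X A D.
  eapply (meet_map_swap_cocartesian (φ1 := unit_over adj A)
    (φ2 := cart c (pr_1_2_2 (base_prod P) U X) D) (a1 := id_over A) (a2 := id_over _)
    (b1 := id_over _) (b2 := id_over D)); try apply iso_id.
  - etransitivity; [apply idl|symmetry; apply idr].
  - etransitivity; [apply idl|symmetry; apply idr].
  - apply H; [|apply cartc]. split; [apply unit_over_cocartesian|apply over_Delta_intro].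
Qed.

Lemma beck_chevalley_product_stable :
  beck_chevalley adj -> product_stable P (cocartesian_over_Delta P).
Proof.
  intros H U V g X A D φ A' D' φ' α β cα cβ e [cφ _].
  split; [|apply over_Delta_intro].
  destruct (cocartesian_comparison cφ (@unit_over_cocartesian _ _ A)) as [i [ii ei]].
  destruct (cartesian_comparison cα (cartc (times_l (base_prod P) g X) A)) as [a [ia ea]].
  (* Correcting [β] by [i] gives it the same target as the lift used in [beck_chevalley_over]; the
     given square then differs from the canonical one by isomorphisms [a] and [b]. *)
  assert (ciβ : is_cartesian p (comp_over i β (comp_id_l _)))
    by (apply cartesian_comp; [now apply iso_cartesian|exact cβ]).
  destruct (cartesian_comparison ciβ (cartc (times_ll (base_prod P) g X)
    (Ex V X A : fibre p (V × X × X)))) as [b [ib eb]].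
  apply (cocartesian_iso_square (φ := beck_chevalley_over adj g A) (α := a) (β := b));
    [exact ia|exact ib| |apply (proj1 beck_chevalley_iff H)].
  eapply (over_cartesian_ext (cartc (times_ll (base_prod P) g X) _));
    [solve_over|solve_over|solve_base|].
  rewrite !assoc, eb. unfold beck_chevalley_over. rewrite lift_comp, !hom_comp_over.
  now rewrite <- assoc, e, assoc, ei, <- !assoc, ea.
Qed.

Lemma product_stable_beck_chevalley :
  product_stable P (cocartesian_over_Delta P) -> beck_chevalley adj.
Proof.
  intros H. apply beck_chevalley_iff. intros Y Z f X A.
  apply (H Y Z f X A (Ex Z X A : fibre p (Z × X × X)) (unit_over adj A)
    _ _ (beck_chevalley_over adj f A) (cart c _ _) (cart c _ _)); [apply cartc|apply cartc| |].
  - apply lift_comp.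
  - split; [apply unit_over_cocartesian|apply over_Delta_intro].
Qed.

End Mates.

Lemma elementary_iff_lifts :
  elementary P <->
  cocartesian_lifts_of_Delta P /\
  (product_stable P (cocartesian_over_Delta P) /\ pairable P (cocartesian_over_Delta P)).
Proof.
  split.
  - intros [Ex [adj [F BC]]]. split; [|split].
    + intros Y X A. eexists _, (unit_over adj A). apply unit_over_cocartesian.
    + now apply beck_chevalley_product_stable with (adj := adj).
    + now apply frobenius_pairable with (adj := adj).
  - intros [H [PS PB]].
    pose (L := fun Y X => constructive_indefinite_description _
      (cocartesian_lifts_adjunction c (f := pr_1_2_2 (base_prod P) Y X) (H Y X))).
    assert (adj : forall Y X : B, inhabited
      (Adjunction (proj1_sig (L Y X)) (reindex c (pr_1_2_2 (base_prod P) Y X))))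
      by exact (fun Y X => proj2_sig (L Y X)).
    assert (adj' : forall Y X : B,
      Adjunction (proj1_sig (L Y X)) (reindex c (pr_1_2_2 (base_prod P) Y X))).
    { intros Y X. assert (e : exists a : Adjunction (proj1_sig (L Y X))
        (reindex c (pr_1_2_2 (base_prod P) Y X)), True) by (destruct (adj Y X); now eexists).
      exact (proj1_sig (constructive_indefinite_description _ e)). }
    exists (fun Y X => proj1_sig (L Y X)), adj'. split.
    + now apply pairable_frobenius.
    + now apply product_stable_beck_chevalley.
Qed.

(** Arrows in Δ have a parameter, so the lift is taken at the parameter 1 and moved along 1 × X ≅
    X. *)
Lemma lifts_loop (X : B) :
  cocartesian_lifts_of_Delta P ->
  exists (I : over (X × X)) (d : HomOver (pr_1_1 (base_prod P) X) (⊤ X) I),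
    is_cocartesian p d.
Proof.
  intros H. destruct (one_map X) as [t]. destruct (one_map (X × X)) as [t2].
  destruct (H (one (base_prod P)) X (⊤ (one (base_prod P) × X))) as [D [φ cφ]].
  pose (i := ⟨⟨t2, pr_1⟩, pr_2⟩ : Hom (X × X) (one (base_prod P) × X × X)).
  assert (ii : is_iso i).
  { exists ⟨pr_2 ∘ pr_1, pr_2⟩. unfold i. split; solve_base. apply one_ext. }
  exists (i ^* D).
  unshelve epose (d := lift (h := pr_1_1 (base_prod P) X) (cartc i D)
    (comp_over φ (bang_over P ⟨t, id X⟩ (⊤ X)) eq_refl) _).
  { unfold i. solve_base. apply one_ext. }
  exists d.
  apply (cocartesian_iso_square (φ := φ) (α := bang_over P ⟨t, id X⟩ (⊤ X)) (β := cart c i D)).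
  - exists (hom_of (bang_over P pr_2 (⊤ (one (base_prod P) × X)))).
    split; (eapply top_ext; [solve_over|solve_over|solve_base; apply one_ext]).
  - apply cartesian_over_iso; [apply cartc|exact ii].
  - apply lift_comp.
  - exact cφ.
Qed.

(** Moved to 1 × X, [∂_X] becomes an arrow [φ1] over Δ. Product-stability along U -> 1 makes φ'
    cocartesian, and pairability adds the factor σ. *)
Lemma stable_pairable_Xi (X : B) (L : Loop P X) :
  is_cocartesian p (loop_arr L) ->
  product_stable P (cocartesian_over_Delta P) -> pairable P (cocartesian_over_Delta P) ->
  forall (A A' : E) (φ : Hom A A'), Xi L φ -> is_cocartesian p φ.
Proof.
  intros cd PS PB A A' φ [U A1 D1 φ' α β C C' ρ σ cα cβ e cρ cσ eρ].
  pose (T := one (base_prod P)).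
  destruct (one_map U) as [g]. destruct (one_map X) as [t]. destruct (one_map (X × X)) as [t2].
  pose (a := cart c (@π2 _ (base_prod P) T X) (⊤ X)).
  pose (b := cart c (pr_2_3 (base_prod P) T X X) (loop_ob L)).
  unshelve epose (φ1 := lift (h := pr_1_2_2 (base_prod P) T X) (cartc (pr_2_3
    (base_prod P) T X X) (loop_ob L))
    (comp_over (loop_arr L) a eq_refl) _).
  { solve_base. }
  assert (e1 : b ∘ φ1 = loop_arr L ∘ a) by apply lift_comp.
  assert (cφ1 : is_cocartesian p φ1).
  { apply (cocartesian_iso_square (φ := loop_arr L) (α := a) (β := b)); [| |exact e1|exact cd];
      (apply cartesian_over_iso; [apply cartc|]).
    - exists ⟨t, id X⟩. split; solve_base. apply one_ext.
    - exists ⟨⟨t2, pr_1⟩, pr_2⟩. split; solve_base. apply one_ext. }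
  unshelve epose (α1 := lift (h := times_l (base_prod P) g X) (cartc (@π2 _ (base_prod P) T X)
    (⊤ X)) α _).
  { solve_base. }
  unshelve epose (β1 := lift (h := times_ll (base_prod P) g X)
    (cartc (pr_2_3 (base_prod P) T X X) (loop_ob L)) β _).
  { solve_base. }
  assert (eα : a ∘ α1 = α) by apply lift_comp.
  assert (eβ : b ∘ β1 = β) by apply lift_comp.
  assert (Q : cocartesian_over_Delta P φ').
  { apply (PS U T g X _ _ φ1 _ _ φ' α1 β1).
    - apply (cartesian_cancel (cartc _ _ : is_cartesian p a)). eapply eq_ind_r; [exact cα|exact eα].
    - apply (cartesian_cancel (cartc _ _ : is_cartesian p b)). eapply eq_ind_r; [exact cβ|exact eβ].
    - eapply (over_cartesian_ext (φ := b) (cartc _ _));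
        [solve_over|solve_over|solve_base|].
      transitivity (β ∘ φ'); [rewrite assoc; exact (f_equal (fun z => z ∘ hom_of φ') eβ)|].
      transitivity (loop_arr L ∘ a ∘ α1);
        [|rewrite assoc; exact (f_equal (fun z => z ∘ hom_of α1) (eq_sym e1))].
      rewrite e, <- assoc. f_equal. symmetry; exact eα.
    - split; [exact cφ1|apply over_Delta_intro]. }
  destruct (PB _ _ _ _ _ φ' _ _ σ Q cσ) as [cm _].
  eapply (meet_map_swap_cocartesian (φ1 := φ') (φ2 := σ) (a1 := id_over _) (a2 := id_over _)
    (b1 := id_over _) (b2 := id_over _)); try apply iso_id; [| |exact cm].
  - etransitivity; [apply idl|symmetry; apply idr].
  - etransitivity; [apply idl|symmetry; apply idr].
Qed.

Lemma point_pr_1_2_2 (U X : B) :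
  point (@π2 _ (base_prod P) U X) = pr_1_2_2 (base_prod P) U X.
Proof. unfold point. solve_base. Qed.

(** * From path induction to an elementary fibration *)

Section LoopConsequences.
Context (L : forall X : B, Loop P X) (H : forall X : B, loop_induction (L X)).

(** The cast makes the base arrow literally [pr_1_2_2], to which [point] is only provably equal. *)
Let refl {U X : B} (A : over (U × X)) :
    HomOver (pr_1_2_2 (base_prod P) U X) A (path_ob pr_2 (loop_ob (L X)) A) :=
  cast_over (point_pr_1_2_2 U X) (refl_path (loop_refl (L X) pr_2) A).

Local Lemma refl_cocartesian (U X : B) (A : over (U × X)) : is_cocartesian p (refl A).
Proof. apply H. Qed.

Lemma loop_lifts : cocartesian_lifts_of_Delta P.
Proof. intros U X A. eexists _, (refl A). apply refl_cocartesian. Qed.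

(** The path objects of [A] and [A'] use the same [∂_X], so a cartesian arrow [τ] maps [refl A'] to
    [refl A]; comparison of cartesian arrows then exhibits φ' as [refl A'] followed by an
    isomorphism. *)
Lemma loop_product_stable : product_stable P (cocartesian_over_Delta P).
Proof.
  intros U V g X A D φ A' D' φ' α β cα cβ e [cφ _].
  split; [|apply over_Delta_intro].
  destruct (cocartesian_comparison (@refl_cocartesian _ _ A) cφ) as [i [ii ei]].
  pose (I := loop_ob (L X)).
  unshelve epose (τ := pack (x := pr_2) (I := I) (A := A) (l := times_ll (base_prod P) g X)
    (comp_over α (base_elt pr_2 I A') eq_refl) (path_elt pr_2 I A') _ _).
  1, 2: unfold ends; solve_base.
  assert (cτ : is_cartesian p τ).
  { apply over_cartesian. intros W h G ψ.
    unshelve epose (a := lift (h := pr_1 ∘ h) cα (comp_over (base_elt pr_2 I A) ψ eq_refl) _).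
    { solve_base. }
    unshelve epose (χ := pack (x := pr_2) (I := I) (A := A') (l := h) a
      (comp_over (path_elt pr_2 I A) ψ eq_refl) eq_refl _).
    { unfold ends; solve_base. }
    exists χ. split.
    - eapply path_ob_ext; [solve_over|solve_over|reflexivity| |]; unfold τ.
      + rewrite base_pack_comp, hom_comp_over, <- assoc. unfold χ. rewrite base_pack.
        apply lift_comp.
      + rewrite path_pack_comp. apply path_pack.
    - intros χ' e'. eapply path_ob_ext; [solve_over|solve_over|reflexivity| |];
        unfold χ; rewrite ?base_pack, ?path_pack.
      + eapply (over_cartesian_ext cα); [solve_over|solve_over|reflexivity|].
        unfold a. rewrite lift_comp, hom_comp_over, <- e'. unfold τ.
        now rewrite base_pack_comp, hom_comp_over, assoc.
      + rewrite hom_comp_over, <- e'. unfold τ. now rewrite path_pack_comp. }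
  assert (ciτ : is_cartesian p (comp_over i τ (comp_id_l _)))
    by (apply cartesian_comp; [now apply iso_cartesian|exact cτ]).
  destruct (cartesian_comparison ciτ cβ) as [j [ij ej]].
  assert (ej' : j ∘ refl A' = φ').
  { eapply (over_cartesian_ext cβ); [solve_over|solve_over|apply comp_id_l|].
    rewrite assoc, ej, e, hom_comp_over, <- ei, <- !assoc. f_equal.
    eapply path_ob_ext; [solve_over|solve_over|solve_base| |];
      unfold τ, refl; simpl hom_of.
    - rewrite base_pack_comp, hom_comp_over, <- assoc, base_refl, assoc, base_refl.
      now rewrite idl, idr.
    - rewrite path_pack_comp, !assoc, !path_refl, !loop_refl_comp, <- !assoc. f_equal.
      eapply top_ext; [solve_over|solve_over|solve_base]. }
  rewrite <- ej'. apply cocartesian_comp; [now apply iso_cocartesian|apply refl_cocartesian].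
Qed.

(** [F] sends (a, k, q) to i(a, q) together with the transport of ψ(k) along q, and extends φ ∧ ψ
    along reflexivity. Its inverse [G] reads off (a, q) through [j] and transports back along the
    inverse of q. *)
Lemma loop_pairable : pairable P (cocartesian_over_Delta P).
Proof.
  apply pairable_intro. intros U X A D φ K' K ψ cφ cψ.
  destruct (cocartesian_comparison (@refl_cocartesian _ _ A) cφ) as [i [ii ei]].
  apply vertical_iso in ii. destruct ii as [i' [i'1 i'2]].
  pose (j := i' : HomOver (id _) D (path_ob pr_2 (loop_ob (L X)) A)).
  assert (ji : j ∘ i = id _) by exact (f_equal (@hom_of _ _ _ _ _ _ _ _) i'1).
  assert (ij : i ∘ j = id _) by exact (f_equal (@hom_of _ _ _ _ _ _ _ _) i'2).
  clearbody j; clear i' i'1 i'2.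
  destruct (transport_exists (@H X) K) as [t et].
  destruct (inverse_exists (@H X)) as [v [ev vv]].
  (* Transport in [K] along a path is invertible, with inverse the transport along its inverse. *)
  unshelve epose (s := pack (x := pr_2) (I := loop_ob (L X)) (A := K)
    (l := ⟨⟨pr_1 ∘ pr_1, pr_2⟩, pr_2 ∘ pr_1⟩) t
    (comp_over v (path_elt pr_2 (loop_ob (L X)) K) eq_refl) _ _).
  1, 2: unfold ends; solve_base.
  assert (ts : t ∘ s = base_elt pr_2 (loop_ob (L X)) K).
  { eapply (over_cocartesian_ext (@H X _ K)); [solve_over|solve_over|solve_base|].
    rewrite base_refl, <- et, <- assoc. f_equal.
    eapply path_ob_ext; [solve_over|solve_over|unfold point; solve_base| |]; unfold s.
    - rewrite base_pack_comp, base_refl. exact et.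
    - rewrite path_pack_comp, path_refl, hom_comp_over, <- assoc, path_refl.
      rewrite loop_refl_comp, assoc, ev. reflexivity. }
  pose (bA := base_elt pr_2 (loop_ob (L X)) (A ⊓ K')). pose (pA := path_elt pr_2 (loop_ob (L X))
    (A ⊓ K')).
  unshelve epose (f1 := pack (x := pr_2) (I := loop_ob (L X)) (A := A) (l := id _)
    (comp_over (meet_pr1 P A K') bA (comp_id_l _)) pA (comp_id_r _) (comp_id_r _)).
  unshelve epose (f2 := pack (x := pr_2) (I := loop_ob (L X)) (A := K)
    (l := ⟨point pr_2 ∘ pr_1, pr_2⟩)
    (comp_over ψ (comp_over (meet_pr2 P A K') bA (comp_id_l _)) eq_refl) pA _ _).
  { unfold point. solve_base. }
  { unfold ends, point. solve_base. }
  unshelve epose (F := pairing_over P (comp_over i f1 (comp_id_l _))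
    (comp_over t f2 _) : HomOver (id _) (path_ob pr_2 (loop_ob (L X)) (A ⊓ K')) (D ⊓ K)).
  { unfold point. solve_base. }
  pose (d := comp_over j (meet_pr1 P D K) (comp_id_l _)).
  pose (q := comp_over (path_elt pr_2 (loop_ob (L X)) A) d (comp_id_r _)).
  unshelve epose (g2 := pack (x := pr_2) (I := loop_ob (L X)) (A := K) (l := ⟨id _, pr_2 ∘ pr_1⟩)
    (meet_pr2 P D K) (comp_over v q eq_refl) _ _).
  1, 2: unfold ends; solve_base.
  (* Transport along the inverse path ends over (u, x, x), where the cartesian arrow ψ turns an
     element of [K] into one of [K']. *)
  unshelve epose (k' := lift (h := pr_1) cψ (comp_over t g2 eq_refl) _).
  { solve_base. }
  pose (G := pack (x := pr_2) (I := loop_ob (L X)) (A := (A ⊓ K')) (l := id _)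
    (pairing_over P (comp_over (base_elt pr_2 (loop_ob (L X)) A) d (comp_id_r _)) k') q
      (comp_id_r _) (comp_id_r _)).
  assert (FG : F ∘ G = id (ob_of (D ⊓ K))).
  { eapply meet_ext; [solve_over|solve_over|solve_base| |]; drop_id; unfold F; rewrite assoc.
    - rewrite pr1_pairing_over, hom_comp_over, <- assoc.
      transitivity (i ∘ (j ∘ meet_pr1 P D K)); [|rewrite assoc, ij; apply idl].
      f_equal. eapply path_ob_ext; [solve_over|solve_over|solve_base| |]; unfold f1.
      + rewrite base_pack_comp, hom_comp_over, <- assoc. unfold bA, G. rewrite base_pack.
        now rewrite pr1_pairing_over.
      + rewrite path_pack_comp. unfold pA, G. now rewrite path_pack.
    - rewrite pr2_pairing_over, hom_comp_over, <- assoc.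
      (* [ts] is used for the path v(q), whose inverse is q again by [vv]. *)
      transitivity (t ∘ (s ∘ g2)); [|rewrite assoc, ts; apply base_pack].
      f_equal. eapply path_ob_ext; [solve_over|solve_over|unfold point; solve_base| |];
        unfold f2, s.
      + rewrite !base_pack_comp, !hom_comp_over, <- !assoc. unfold bA, G. rewrite base_pack.
        rewrite pr2_pairing_over. apply lift_comp.
      + rewrite !path_pack_comp. unfold pA, G, g2. rewrite path_pack, hom_comp_over, <- assoc.
        rewrite path_pack, hom_comp_over, assoc, vv. symmetry; apply idl. }
  assert (Fr : F ∘ refl (A ⊓ K') = meet_map P φ ψ).
  { eapply meet_ext; [solve_over|solve_over|solve_base| |]; unfold F, meet_map; rewrite assoc.
    - rewrite !pr1_pairing_over, !hom_comp_over, <- assoc, <- ei, <- assoc. f_equal.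
      eapply path_ob_ext; [solve_over|solve_over|solve_base| |]; unfold f1, refl; simpl hom_of.
      + rewrite base_pack_comp, hom_comp_over, <- assoc. unfold bA.
        rewrite base_refl, assoc, base_refl, idl. apply idr.
      + rewrite path_pack_comp, assoc. unfold pA. rewrite !path_refl, <- assoc. f_equal.
        eapply top_ext; [solve_over|solve_over|solve_base].
    - rewrite !pr2_pairing_over, !hom_comp_over, <- assoc.
      transitivity (t ∘ (refl_path (loop_refl (L X) pr_2) K ∘ (ψ ∘ meet_pr2 P A K')));
        [|rewrite assoc, et; apply idl]. f_equal.
      eapply path_ob_ext; [solve_over|solve_over|unfold point; solve_base| |];
        unfold f2, refl; simpl hom_of.
      + rewrite base_pack_comp, !hom_comp_over, <- !assoc. unfold bA.
        rewrite base_refl, idr, assoc, base_refl. symmetry; apply idl.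
      + rewrite path_pack_comp, assoc. unfold pA. rewrite !path_refl, !loop_refl_comp, <- assoc.
        f_equal. eapply top_ext; [solve_over|solve_over|solve_base]. }
  (* By the uniqueness in path induction it is enough to compare on reflexivity, where [F] becomes φ
     ∧ ψ and the path extracted by [j] is [∂_X]. *)
  assert (GF : G ∘ F = id (ob_of (path_ob pr_2 (loop_ob (L X)) (A ⊓ K')))).
  { eapply (over_cocartesian_ext (@refl_cocartesian _ _ (A ⊓ K')));
      [solve_over|solve_over|apply comp_id_l|].
    transitivity (G ∘ meet_map P φ ψ);
      [rewrite <- assoc; exact (f_equal (fun z => G ∘ z) Fr)|].
    etransitivity; [|symmetry; apply idl].
    assert (er : j ∘ φ = refl A) by (rewrite <- ei, assoc, ji; apply idl).
    assert (ed : d ∘ meet_map P φ ψ = refl A ∘ meet_pr1 P A K').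
    { unfold d, meet_map.
      now rewrite hom_comp_over, <- assoc, pr1_pairing_over, hom_comp_over, assoc, er. }
    assert (eq : q ∘ meet_map P φ ψ = loop_arr (L X) ∘ bang_over P pr_2 (A ⊓ K')).
    { unfold q. rewrite hom_comp_over, <- assoc, ed. unfold refl; simpl hom_of.
      rewrite assoc. rewrite path_refl, loop_refl_comp, <- assoc. f_equal.
      eapply top_ext; [solve_over|solve_over|solve_base]. }
    eapply path_ob_ext; [solve_over|solve_over|solve_base| |]; unfold G.
    - rewrite base_pack_comp. unfold refl; simpl hom_of. rewrite base_refl.
      eapply meet_ext; [solve_over|solve_over|solve_base| |]; drop_id; rewrite assoc.
      + rewrite pr1_pairing_over, hom_comp_over, <- assoc, ed. unfold refl; simpl hom_of.
        rewrite assoc, base_refl. apply idl.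
      + rewrite pr2_pairing_over.
        eapply (over_cartesian_ext cψ); [solve_over|solve_over|solve_base|].
        unfold k'. rewrite assoc, lift_comp, hom_comp_over, <- assoc.
        transitivity (t ∘ (refl_path (loop_refl (L X) pr_2) K ∘ (ψ ∘ meet_pr2 P A K')));
          [|rewrite assoc, et; apply idl]. f_equal.
        eapply path_ob_ext; [solve_over|solve_over|unfold point; solve_base| |];
          unfold g2.
        * rewrite base_pack_comp, assoc, base_refl, idl. unfold meet_map.
          now rewrite pr2_pairing_over.
        * rewrite path_pack_comp, hom_comp_over, <- assoc, eq, assoc, ev, assoc, path_refl.
          rewrite loop_refl_comp, <- assoc. f_equal.
          eapply top_ext; [solve_over|solve_over|solve_base].
    - rewrite path_pack_comp, eq. unfold refl; simpl hom_of.
      rewrite path_refl, loop_refl_comp. f_equal.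
      eapply top_ext; [solve_over|solve_over|solve_base]. }
  refine (eq_ind _ (fun z => is_cocartesian p z) _ _ Fr).
  apply cocartesian_comp; [|apply refl_cocartesian].
  apply iso_cocartesian. now exists G.
Qed.

Lemma loop_elementary : elementary P.
Proof.
  apply elementary_iff_lifts. split; [exact loop_lifts|].
  split; [exact loop_product_stable|exact loop_pairable].
Qed.

End LoopConsequences.

(** * Condition (vi): the adjunction given by meeting with [I_X] *)

Section TransportFunctor.
Context {X : B} (I : over (X × X)).

Let Fun (U : B) : Functor (fibre p (U × X)) (fibre p (U × X × X)) :=
  transport_functor P U X I.
Local Notation F A :=
  ((pr_1_2 (base_prod P) _ X X ^* A) ⊓ (pr_2_3 (base_prod P) _ X X ^* I)).

Local Lemma transport_functor_pr1 (U : B) (A A' : fibre p (U × X)) (v : Hom A A') :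
  meet_pr1 P _ _ ∘ hom_of (fmap (Fun U) v) =
  reindex_map c (pr_1_2 (base_prod P) U X X) v ∘ meet_pr1 P _ (pr_2_3 (base_prod P) U X X ^* I).
Proof.
  exact (f_equal (@hom_of _ _ _ _ _ _ _ _) (π1_pairing (fibre_prod P (U × X × X)) _ _)).
Qed.

Local Lemma transport_functor_pr2 (U : B) (A A' : fibre p (U × X)) (v : Hom A A') :
  meet_pr2 P _ _ ∘ hom_of (fmap (Fun U) v) =
  meet_pr2 P (pr_1_2 (base_prod P) U X X ^* A) (pr_2_3 (base_prod P) U X X ^* I).
Proof.
  exact (f_equal (@hom_of _ _ _ _ _ _ _ _) (π2_pairing (fibre_prod P (U × X × X)) _ _)).
Qed.

Local Lemma transport_path_ob (U : B) (A : over (U × X)) :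
  exists i : HomOver (id _) (F A) (path_ob pr_2 I A), is_iso (hom_of i) /\
    base_elt pr_2 I A ∘ i = cart c (pr_1_2 (base_prod P) U X X) A ∘ meet_pr1 P _ _ /\
    path_elt pr_2 I A ∘ i = cart c (pr_2_3 (base_prod P) U X X) I ∘ meet_pr2 P _ _.
Proof. apply path_ob_compare; [solve_base|unfold ends; solve_base|apply cartc|apply cartc]. Qed.

Lemma path_induction_adjunction (U : B)
    (k : HomOver ⟨@π2 _ (base_prod P) U X, pr_2⟩ (⊤ (U × X)) I) :
  path_induction k ->
  inhabited (Adjunction (transport_functor P U X I) (reindex c (pr_1_2_2 (base_prod P) U X))).
Proof.
  intros H.
  pose (kk := fun A : over (U × X) => comp_over k (bang_over P (id _) A) (comp_id_r _)).
  pose (φ := fun A : over (U × X) => pairing_over P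
    (lift (h := pr_1_2_2 (base_prod P) U X) (cartc (pr_1_2 (base_prod P) U X X) A) (id_over A)
      ltac:(solve_base))
    (lift (h := pr_1_2_2 (base_prod P) U X) (cartc (pr_2_3 (base_prod P) U X X) I) (kk A)
      ltac:(solve_base))).
  apply (@cocartesian_adjunction _ _ _ c _ _ _ (transport_functor P U X I) φ).
  - intros A. destruct (transport_path_ob A) as [i [ii [i1 i2]]].
    eapply (cocartesian_iso_square (α := id _) (β := i)); [apply iso_id|exact ii| |apply (H A)].
    drop_id. eapply path_ob_ext; [solve_over|solve_over|unfold point; solve_base| |];
      rewrite assoc.
    + rewrite i1, base_refl, <- assoc. unfold φ. rewrite pr1_pairing_over. apply lift_comp.
    + rewrite i2, path_refl, <- assoc. unfold φ. rewrite pr2_pairing_over. apply lift_comp.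
  - intros A A' v. eapply meet_ext.
    + eapply over_comp; [apply hom_over|exact (hom_over (v : HomOver (id _) A A'))].
    + eapply over_comp; [exact (hom_over (fmap (Fun U) v : HomOver (id _) (F A)
      (F A')))|apply hom_over].
    + rewrite comp_id_l. apply comp_id_r.
    + etransitivity; [|symmetry; rewrite assoc;
        exact (f_equal (fun z => z ∘ hom_of (φ A)) (transport_functor_pr1 v))].
      unfold φ. rewrite assoc, pr1_pairing_over, <- assoc, pr1_pairing_over.
      eapply (over_cartesian_ext (cartc (pr_1_2 (base_prod P) U X X) A')).
      * eapply over_comp; [apply hom_over|exact (hom_over (v : HomOver (id _) A A'))].
      * solve_over.
      * rewrite comp_id_l. apply comp_id_r.
      * rewrite !assoc, lift_comp, cart_reindex, <- assoc, lift_comp.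
        etransitivity; [apply idl|symmetry; apply idr].
    + etransitivity; [|symmetry; rewrite assoc;
        exact (f_equal (fun z => z ∘ hom_of (φ A)) (transport_functor_pr2 v))].
      unfold φ. rewrite assoc, !pr2_pairing_over.
      eapply (over_cartesian_ext (cartc (pr_2_3 (base_prod P) U X X) I)).
      * eapply over_comp; [apply hom_over|exact (hom_over (v : HomOver (id _) A A'))].
      * solve_over.
      * apply comp_id_r.
      * rewrite assoc, !lift_comp. unfold kk. rewrite !hom_comp_over, <- assoc. f_equal.
        eapply top_ext; [|solve_over|apply comp_id_l].
        eapply over_comp; [apply hom_over|exact (hom_over (v : HomOver (id _) A A'))].
Qed.

(* The unit of an abstract adjunction may differ from [refl_path k] by a natural
   endomorphism [e] of the identity; [e] has a retraction [s], and [e s = s e] by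
   naturality, so that [e] is invertible. *)
Lemma adjunction_path_induction (U : B) :
  Adjunction (transport_functor P U X I) (reindex c (pr_1_2_2 (base_prod P) U X)) ->
  exists k : HomOver ⟨@π2 _ (base_prod P) U X, pr_2⟩ (⊤ (U × X)) I, path_induction k.
Proof.
  intros adj.
  pose (η := fun A : over (U × X) =>
    colift_unit adj A : HomOver (pr_1_2_2 (base_prod P) U X) A (F A)).
  assert (cη : forall A, is_cocartesian p (η A))
    by exact (fun A => colift_unit_cocartesian (adj := adj) (A := A)).
  pose (ρ := fun A : over (U × X) => comp_over (cart c (pr_1_2 (base_prod P) U X X) A)
    (meet_pr1 P _ (pr_2_3 (base_prod P) U X X ^* I)) (comp_id_r _) :
    HomOver _ (F A) A).
  pose (π := fun A : over (U × X) => comp_over (cart c (pr_2_3 (base_prod P) U X X) I)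
    (meet_pr2 P (pr_1_2 (base_prod P) U X X ^* A) _) (comp_id_r _) :
    HomOver _ (F A) I).
  assert (nρ : forall (A A' : over (U × X)) (v : HomOver (id _) A A'),
    ρ A' ∘ (η A' ∘ v) = v ∘ (ρ A ∘ η A)).
  { intros A A' v.
    transitivity (ρ A' ∘ (hom_of (fmap (Fun U) (v : @Hom (fibre p _) A A')) ∘ η A)).
    - exact (f_equal (fun z => ρ A' ∘ z) (colift_unit_natural adj (v : @Hom (fibre p _) A A'))).
    - rewrite !assoc. f_equal. unfold ρ. rewrite !hom_comp_over, assoc, <- cart_reindex.
      rewrite <- !assoc. f_equal. apply (transport_functor_pr1 (v : @Hom (fibre p _) A A')). }
  (* The functor leaves the factor [I] fixed, so by naturality the path component of the unit at any
     [A] is induced by the one at ⊤, which becomes [k]. *)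
  assert (nπ : forall (A A' : over (U × X)) (v : HomOver (id _) A A'),
    π A' ∘ (η A' ∘ v) = π A ∘ η A).
  { intros A A' v.
    transitivity (π A' ∘ (hom_of (fmap (Fun U) (v : @Hom (fibre p _) A A')) ∘ η A)).
    - exact (f_equal (fun z => π A' ∘ z) (colift_unit_natural adj (v : @Hom (fibre p _) A A'))).
    - rewrite !assoc. f_equal. unfold π. rewrite !hom_comp_over.
      rewrite <- assoc. f_equal. apply (transport_functor_pr2 (v : @Hom (fibre p _) A A')). }
  unshelve epose (k := comp_over (π (⊤ (U × X))) (η (⊤ (U × X))) _ :
    HomOver ⟨@π2 _ (base_prod P) U X, pr_2⟩ (⊤ (U × X)) I).
  { solve_base. }
  exists k. intros A.
  unshelve epose (e := comp_over (ρ A) (η A) _ : HomOver (id _) A A).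
  { solve_base. }
  destruct (transport_path_ob A) as [i [[i' [ii1 ii2]] [i1 i2]]].
  assert (ie : i ∘ η A = refl_path k A ∘ e).
  { eapply path_ob_ext; [solve_over|solve_over|unfold point; solve_base| |]; rewrite !assoc.
    - rewrite i1, base_refl, idl. reflexivity.
    - rewrite i2, path_refl. symmetry.
      transitivity (π (⊤ (U × X)) ∘ (η (⊤ (U × X)) ∘ bang_over P (id _) A)); [|apply nπ].
      unfold k. rewrite hom_comp_over, <- !assoc. do 2 f_equal.
      eapply top_ext; [solve_over|solve_over|solve_base]. }
  destruct (colift_exists (h := pr_1_2 (base_prod P) U X X) (cη A) (id_over A)) as [t et].
  { solve_base. }
  assert (oi : is_over (id _) i').
  { apply (iso_over_inverse (φ := i) (comp_id_l _) (comp_id_l _) ii1 ii2). }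
  (* [t] retracts [η A] over the projection; since [i] takes [η A] to [refl_path k A ∘ e], composing
     [t ∘ i'] with [refl_path k A] gives a retraction of [e]. *)
  unshelve epose (s := comp_over (comp_over t (Build_HomOver oi) (comp_id_r _))
    (refl_path k A) _ : HomOver (id _) A A).
  { unfold point. solve_base. }
  assert (se : s ∘ e = id (ob_of A)).
  { unfold s. rewrite !hom_comp_over, <- !assoc, <- ie. simpl hom_of.
    rewrite (@comp_assoc E _ _ _ _ i' i), ii1, idl. exact et. }
  assert (es : e ∘ s = id (ob_of A)).
  { rewrite <- se. unfold e. rewrite hom_comp_over, <- assoc. apply nρ. }
  eapply (cocartesian_iso_square (φ := η A) (α := s) (β := i')); [now exists e|now exists i|
    |apply cη].
  rewrite <- (idr (refl_path k A)), <- es, (@comp_assoc E _ _ _ _ (refl_path k A)), <- ie.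
  now rewrite !assoc, ii1, idl.
Qed.

(** [∂_X] is read off from the section for U = 1. Its reindexing to U × X need not be the section
    supplied for U, hence the appeal to [path_induction_any]. *)
Lemma path_induction_loop :
  (forall U : B, exists k : HomOver ⟨@π2 _ (base_prod P) U X, pr_2⟩ (⊤ (U × X)) I,
     path_induction k) ->
  exists L : Loop P X, loop_induction L.
Proof.
  intros H. destruct (one_map X) as [t].
  destruct (H (one (base_prod P))) as [k1 _].
  unshelve epose (d := comp_over k1 (bang_over P ⟨t, id X⟩ (⊤ X)) _ :
    HomOver (pr_1_1 (base_prod P) X) (⊤ X) I).
  { solve_base. }
  exists (Build_Loop d). intros U.
  destruct (H U) as [k Hk]. destruct (H (U × X)) as [k2 Hk2].
  (* [k2] is based at the last coordinate, but the second section in [path_induction_any] must be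
     based at the middle one. *)
  pose (i := ⟨⟨pr_1 ∘ pr_1, pr_2⟩, pr_2 ∘ pr_1⟩ : Hom (U × X × X) (U × X × X)).
  unshelve epose (k' := comp_over k2 (bang_over P i (⊤ (U × X × X))) _ :
    HomOver ⟨@π2 _ (base_prod P) U X ∘ pr_1, pr_2 ∘ pr_1⟩ (⊤ (U × X × X)) I).
  { unfold i. solve_base. }
  apply (path_induction_any (k := k) (k' := k')); [exact Hk|].
  apply (path_induction_transfer (i := i) (k := k2)); [|unfold i; solve_base|reflexivity|exact Hk2].
  exists i. unfold i. split; solve_base.
Qed.

End TransportFunctor.

End Paths.

Theorem theorem4p8 (E B : Category) (p : Functor E B) (c : Cleavage p)
    (P : FibredFiniteProducts c) :
  let cond_i := elementary P in
  let cond_ii :=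
    cocartesian_lifts_of_Delta P /\
    (product_stable P (cocartesian_over_Delta P) /\
     pairable P (cocartesian_over_Delta P)) in
  let cond_iii :=
    (forall X : B, exists (I : ObOver p (product (base_prod P) X X))
        (d : HomOver (pr_1_1 (base_prod P) X) (top P X) I), is_cocartesian p d) /\
    (product_stable P (cocartesian_over_Delta P) /\
     pairable P (cocartesian_over_Delta P)) in
  let cond_iv :=
    exists T : forall X : B, StrictTransporter P X,
      productive T /\
      forall (X : B) (A A' : E) (φ : Hom A A'),
        Xi (tr_loop (T X)) φ -> locally_epic p φ in
  let cond_v :=
    exists L : forall X : B, Loop P X,
      forall (X : B) (A A' : E) (φ : Hom A A'), Xi (L X) φ -> is_cocartesian p φ in
  let cond_vi :=
    exists I : forall X : B, ObOver p (product (base_prod P) X X),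
      forall Y X : B,
        inhabited (Adjunction (transport_functor P Y X (I X))
                              (reindex c (pr_1_2_2 (base_prod P) Y X))) in
  (cond_i <-> cond_ii) /\
  (cond_i <-> cond_iii) /\
  (cond_i <-> cond_iv) /\
  (cond_i <-> cond_v) /\
  (cond_i <-> cond_vi).
Proof.
  intros cond_i cond_ii cond_iii cond_iv cond_v cond_vi.
  assert (i_ii : cond_i <-> cond_ii) by apply elementary_iff_lifts.
  (* Path induction is the form of (v) through which (i), (iv) and (vi) are reached. *)
  assert (v_ind : cond_v <-> exists L : forall X : B, Loop P X, forall X, loop_induction (L X)).
  { split; intros [L H]; exists L; intros X.
    - exact (proj1 (Xi_cocartesian (L X)) (H X)).
    - exact (proj2 (Xi_cocartesian (L X)) (H X)). }
  assert (ii_iii : cond_ii -> cond_iii).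
  { intros [H H']. split; [intros X; now apply lifts_loop|exact H']. }
  assert (iii_v : cond_iii -> cond_v).
  { intros [H [PS PB]].
    assert (H' : forall X, {L : Loop P X | is_cocartesian p (loop_arr L)}).
    { intros X. apply constructive_indefinite_description.
      destruct (H X) as [I [d cd]]. now exists (Build_Loop d). }
    exists (fun X => proj1_sig (H' X)). intros X.
    apply stable_pairable_Xi; [exact (proj2_sig (H' X))|exact PS|exact PB]. }
  assert (v_i : cond_v -> cond_i).
  { intros H. apply v_ind in H. destruct H as [L H]. exact (loop_elementary H). }
  assert (v_iv : cond_v -> cond_iv).
  { intros H. apply v_ind in H. destruct H as [L H].
    pose (t := fun X A => constructive_indefinite_description _ (carrier_exists (H X) A)).
    exists (fun X => {| tr_loop := L X; tr_carrier := fun A => proj1_sig (t X A);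
                        tr_strict := fun A => proj2_sig (t X A) |}).
    split; [exact (box_exists H)|].
    intros X A A' φ Q. apply cocartesian_locally_epic. exact (proj2 (Xi_cocartesian (L X))
      (H X) _ _ _ Q). }
  assert (iv_v : cond_iv -> cond_v).
  { intros [T [H1 H2]]. apply v_ind. exists (fun X => tr_loop (T X)).
    now apply locally_epic_loop_induction. }
  assert (v_vi : cond_v -> cond_vi).
  { intros H. apply v_ind in H. destruct H as [L H].
    exists (fun X => loop_ob (L X)). intros Y X.
    exact (path_induction_adjunction (H X Y)). }
  assert (vi_v : cond_vi -> cond_v).
  { intros [I H]. apply v_ind.
    assert (H' : forall X, {L : Loop P X | loop_induction L}).
    { intros X. apply constructive_indefinite_description.
      apply (path_induction_loop (I := I X)). intros U. destruct (H U X) as [adj].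
      exact (adjunction_path_induction adj). }
    exists (fun X => proj1_sig (H' X)). exact (fun X => proj2_sig (H' X)). }
  tauto.
Qed.
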